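(* Let $\mathbb{K}$ be a field of characteristic $0$ and $(\alpha,\beta,\gamma)\in\mathbb{K}^3$. The down-up algebra $A(\alpha,\beta,\gamma)$ is monomial if and only if $(\alpha,\beta,\gamma)=(0,0,0)$.
   Context: For $(\alpha,\beta,\gamma)\in\mathbb{K}^3$, the down-up algebra $A(\alpha,\beta,\gamma)$ is the quotient of the free associative algebra $\mathbb{K}\langle d,u\rangle$ by the two-sided ideal generated by $d^2u-(\alpha dud+\beta ud^2+\gamma d)$ and $du^2-(\alpha udu+\beta u^2d+\gamma u)$. A $\mathbb{K}$-algebra is called monomial if it is isomorphic to an algebra of the form $\mathbb{K}Q/I$, where $Q$ is a quiver with a finite number of vertices, $\mathbb{K}Q$ its path algebra, and $I$ a two-sided ideal of $\mathbb{K}Q$ generated by paths of length at least $2$. *)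

(* Defs.v *)
From HB Require Import structures.
From mathcomp Require Import all_boot all_order all_algebra.
Set Implicit Arguments. Unset Strict Implicit. Unset Printing Implicit Defensive.
Import GRing.Theory.
Local Open Scope ring_scope.

(** * Algebras with a multiplicative basis, as formal linear combinations.

   Given a type [M] of basis elements and a partial product
   [mulM : M -> M -> option M] ([None] meaning the product is zero),
   an element of the algebra is a finite formal linear combination,
   represented as a list of (coefficient, basis element) pairs.  Two
   lists represent the same element iff all their coefficients agree
   ([lceq]). *)

Section LinComb.
Variables (K : fieldType) (M : eqType).

Definition lc := seq (K * M).

Definition coef (x : lc) (m : M) : K := \sum_(p <- x | p.2 == m) p.1.

Definition lceq (x y : lc) : Prop := forall m, coef x m = coef y m.

Definition lcscale (c : K) (x : lc) : lc := [seq (c * p.1, p.2) | p <- x].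

Definition lcadd (x y : lc) : lc := x ++ y.

Definition lcsub (x y : lc) : lc := x ++ lcscale (-1) y.

Definition lcsum (s : seq lc) : lc := flatten s.

Variable mulM : M -> M -> option M.

Definition lcmul (x y : lc) : lc :=
  pmap (fun pq : (K * M) * (K * M) =>
          omap (fun m => (pq.1.1 * pq.2.1, m)) (mulM pq.1.2 pq.2.2))
       [seq (p, q) | p <- x, q <- y].

Definition in_ideal (G : lc -> Prop) (x : lc) : Prop :=
  exists s : seq (lc * lc * lc),
    (forall t, t \in s -> G t.1.2) /\
    lceq x (lcsum [seq lcmul (lcmul t.1.1 t.1.2) t.2 | t <- s]).

End LinComb.

Definition word := seq bool.
Definition wmul (v w : word) : option word := Some (v ++ w).
Definition dL : bool := false.
Definition uL : bool := true.

Definition wmono (K : fieldType) (c : K) (w : word) : lc K word := [:: (c, w)].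

Definition du_rel1 (K : fieldType) (a b g : K) : lc K word :=
  [:: (1, [:: dL; dL; uL]); (- a, [:: dL; uL; dL]);
      (- b, [:: uL; dL; dL]); (- g, [:: dL])].
Definition du_rel2 (K : fieldType) (a b g : K) : lc K word :=
  [:: (1, [:: dL; uL; uL]); (- a, [:: uL; dL; uL]);
      (- b, [:: uL; uL; dL]); (- g, [:: uL])].

Definition du_ideal (K : fieldType) (a b g : K) : lc K word -> Prop :=
  in_ideal wmul (fun r => r = du_rel1 a b g \/ r = du_rel2 a b g).

(** * Path algebras of quivers with finitely many vertices.

   A quiver has vertex set ['I_n] and an arbitrary type [E] of arrows with
   source and target maps.  A (raw) path is a pair [(v, as)] of a start
   vertex and a list of arrows; it is a genuine path ([valid]) when the
   first arrow starts at [v] and each arrow starts where the previous one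
   ends.  [(v, [::])] is the trivial path at [v].  Paths are concatenated
   left to right. *)

Section Quiver.
Variables (n : nat) (E : eqType) (src tgt : E -> 'I_n).

Definition qpath : eqType := ('I_n * seq E)%type.

Fixpoint valid_from (v : 'I_n) (as_ : seq E) : bool :=
  if as_ is a :: as' then (src a == v) && valid_from (tgt a) as' else true.

Definition valid (p : qpath) : bool := valid_from p.1 p.2.

Definition pend (p : qpath) : 'I_n := last p.1 (map tgt p.2).

Definition plen (p : qpath) : nat := size p.2.

Definition pmul (p q : qpath) : option qpath :=
  if valid p && valid q && (pend p == q.1) then Some (p.1, p.2 ++ q.2)
  else None.

Definition qunit (K : fieldType) : lc K qpath :=
  [seq (1, (v, [::])) | v <- enum 'I_n].

Definition in_KQ (K : fieldType) (y : lc K qpath) : bool :=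
  all (fun p => valid p.2) y.

Definition path_ideal (K : fieldType) (Gp : qpath -> Prop) : lc K qpath -> Prop :=
  in_ideal pmul (fun r => exists p, Gp p /\ r = [:: (1, p)]).

Definition word_img (K : fieldType) (D U : lc K qpath) (w : word) : lc K qpath :=
  foldr (fun b acc => lcmul pmul (if b then U else D) acc) (qunit K) w.

Definition free_to_KQ (K : fieldType) (D U : lc K qpath) (x : lc K word)
  : lc K qpath :=
  lcsum [seq lcscale p.1 (word_img D U p.2) | p <- x].

End Quiver.

(** * Monomiality of an algebra presented as K<d,u>/J.

   K<d,u>/J is isomorphic (as a K-algebra) to KQ/I, where I is generated by
   paths of length >= 2, iff there are D, U in KQ such that the unital
   algebra map K<d,u> -> KQ, d |-> D, u |-> U, induces an isomorphism
   K<d,u>/J -> KQ/I, i.e. it is surjective modulo I and its preimage of I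
   is exactly J. *)
Definition monomial_quotient (K : fieldType) (J : lc K word -> Prop) : Prop :=
  exists (n : nat) (E : eqType) (src tgt : E -> 'I_n)
         (Gp : qpath n E -> Prop),
    (forall p, Gp p -> valid src tgt p /\ (2 <= plen p)%N) /\
    exists D U : lc K (qpath n E),
      [/\ in_KQ src tgt D, in_KQ src tgt U,
          (forall y : lc K (qpath n E), in_KQ src tgt y ->
             exists x : lc K word,
               path_ideal src tgt Gp (lcsub y (free_to_KQ src tgt D U x))) &
          (forall x : lc K word,
             path_ideal src tgt Gp (free_to_KQ src tgt D U x) <-> J x)].

Definition down_up_monomial (K : fieldType) (a b g : K) : Prop :=
  monomial_quotient (du_ideal a b g).

(* Main.v *)
From HB Require Import structures.
From mathcomp Require Import all_boot all_order all_algebra ring.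
From Stdlib Require Import ClassicalEpsilon.
Require Import Defs.
Set Implicit Arguments. Unset Strict Implicit. Unset Printing Implicit Defensive.
Import GRing.Theory.
Local Open Scope ring_scope.

(* Suppose A(a,b,g) is KQ/I with I monomial. Representations of KQ/I in an algebra B
   correspond to pairs (d, u) in B satisfying the down-up relations, and the subalgebra
   they generate is the image of KQ. A nonzero representation in a commutative domain is
   supported on the loops at one vertex v; since I is generated by paths, the loops with
   nonzero value may then be reassigned arbitrary values in any algebra, and still define
   a representation of KQ/I. Put s = 1 - a - b.
   - g <> 0: sending a loop to 'X in K['X] would make d and u constant, so all loops vanish
     in K['X]. If s <> 0, the characters d = t, u = g / (s t) are then infinitely many,
     while their value on d is determined by v. If s = 0, commuting d and u must vanish, so
     there is one vertex and no loop, and A = K; but A has a nontrivial 3-dimensional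
     representation.
   - g = 0: no two loops x <> y can be nonzero in a domain, since they would be free: if
     s <> 0, then x = 'X^2 and y = 'X^3 would force d = 0 or u = 0, and the cuspidal
     subalgebra is not generated by one element; if s = 0, the relation fails in upper
     triangular 4x4 matrices. Hence the representations ('X, 0) and (0, 'X) yield loops
     x <> y at the same vertex, equal to d and u up to scalars and higher order terms.
     Were xxy not in I, the same matrices would represent KQ/I; so d^2 u vanishes in the
     degree 3 part of A, whence a = b = 0. *)

(** * Linear extension from a basis, and two-sided ideals of formal combinations *)

Section LinearExtension.
Variables (K : fieldType) (M : eqType).
Implicit Types x y z : lc K M.

Definition ev (V : lmodType K) (h : M -> V) x : V := \sum_(p <- x) p.1 *: h p.2.

Lemma ev_nil (V : lmodType K) (h : M -> V) : ev h [::] = 0.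
Proof. by rewrite /ev big_nil. Qed.

Lemma ev_cons (V : lmodType K) (h : M -> V) p x :
  ev h (p :: x) = p.1 *: h p.2 + ev h x.
Proof. by rewrite /ev big_cons. Qed.

Lemma ev1 (V : lmodType K) (h : M -> V) m : ev h [:: (1, m)] = h m.
Proof. by rewrite ev_cons ev_nil addr0 scale1r. Qed.

Lemma ev_cat (V : lmodType K) (h : M -> V) x y : ev h (x ++ y) = ev h x + ev h y.
Proof. by rewrite /ev big_cat. Qed.

Lemma ev_scale (V : lmodType K) (h : M -> V) c x :
  ev h (lcscale c x) = c *: ev h x.
Proof.
rewrite /ev big_map scaler_sumr; apply: eq_bigr => p _.
by rewrite /= scalerA.
Qed.

Lemma ev_sub (V : lmodType K) (h : M -> V) x y : ev h (lcsub x y) = ev h x - ev h y.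
Proof. by rewrite ev_cat ev_scale scaleN1r. Qed.

Lemma ev_lcsum (V : lmodType K) (h : M -> V) s :
  ev h (lcsum s) = \sum_(x <- s) ev h x.
Proof.
elim: s => [|x s IH]; first by rewrite big_nil ev_nil.
by rewrite big_cons -IH -ev_cat.
Qed.

Lemma eq_ev (V : lmodType K) (h h' : M -> V) x : h =1 h' -> ev h x = ev h' x.
Proof. by move=> e; apply: eq_bigr => p _; rewrite e. Qed.

Lemma ev0 (V : lmodType K) x : ev (fun=> 0 : V) x = 0.
Proof. by apply: big1 => p _; rewrite scaler0. Qed.

Lemma ev_add (V : lmodType K) (h h' : M -> V) x :
  ev (fun m => h m + h' m) x = ev h x + ev h' x.
Proof. by rewrite -big_split; apply: eq_bigr => p _; rewrite scalerDr. Qed.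

Lemma ev_opp (V : lmodType K) (h : M -> V) x : ev (fun m => - h m) x = - ev h x.
Proof. by rewrite -sumrN; apply: eq_bigr => p _; rewrite scalerN. Qed.

Lemma ev_additive (V W : lmodType K) (h : M -> V) (f : {linear V -> W}) x :
  f (ev h x) = ev (f \o h) x.
Proof. by rewrite linear_sum; apply: eq_bigr => p _; rewrite linearZ. Qed.

Lemma ev_closed (V : lmodType K) (S : V -> Prop) (h : M -> V) x :
  S 0 -> (forall c v w, S v -> S w -> S (c *: v + w)) -> (forall m, S (h m)) ->
  S (ev h x).
Proof.
move=> S0 SD Sh; elim: x => [|p x IH]; first by rewrite ev_nil.
by rewrite ev_cons; apply: SD.
Qed.

Lemma coef_indicator x m : coef x m = ev (fun m' => (m' == m)%:R : K^o) x.
Proof.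
rewrite /coef /ev big_mkcond; apply: eq_bigr => p _.
by case: eqP => _; rewrite /= ?scaler0 // /GRing.scale /= mulr1.
Qed.

Lemma coef_sum_indicator x m : coef x m = \sum_(p <- x) p.1 * (p.2 == m)%:R.
Proof. exact: coef_indicator. Qed.

(** Grouping terms by basis element shows that [ev] depends on the coefficients alone, so it
    descends to [lceq] classes. *)
Lemma ev_coef (V : lmodType K) (h : M -> V) (r : seq M) x : uniq r ->
  {subset map snd x <= r} -> ev h x = \sum_(m <- r) coef x m *: h m.
Proof.
move=> ur; elim: x => [|[c m] x IH] sub.
  by rewrite ev_nil big1 // => m _; rewrite /coef big_nil scale0r.
have mr : m \in r by apply: sub; rewrite inE eqxx.
rewrite ev_cons IH; last by move=> z zx; apply: sub; rewrite inE zx orbT.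
rewrite (bigD1_seq m) //= [in RHS](bigD1_seq m) //= addrA.
rewrite /coef big_cons /= eqxx scalerDl; congr (_ + _).
by apply: eq_bigr => z zm; rewrite big_cons /= eq_sym (negbTE zm).
Qed.

Lemma lceq_ev (V : lmodType K) (h : M -> V) x y : lceq x y -> ev h x = ev h y.
Proof.
move=> e; set r := undup (map snd x ++ map snd y).
have ur : uniq r by apply: undup_uniq.
rewrite (@ev_coef _ h r x) // ?(@ev_coef _ h r y) //.
- by apply: eq_bigr => m _; rewrite e.
- by move=> m; rewrite mem_undup mem_cat => ->; rewrite orbT.
- by move=> m; rewrite mem_undup mem_cat => ->.
Qed.

(** Coefficients are themselves linear extensions of indicator functions. Identities up to [lceq]
    are proved below by testing them against an arbitrary linear form. *)
Lemma ev_lceq x y : (forall h : M -> K^o, ev h x = ev h y) -> lceq x y.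
Proof. by move=> e m; rewrite !coef_indicator e. Qed.

Variable mulM : M -> M -> option M.

(** The default 0 of [oapp] matches the terms that [lcmul] drops, so products become iterated
    extensions and bilinear identities reduce to basis elements. *)
Lemma ev_lcmul (V : lmodType K) (h : M -> V) x y :
  ev h (lcmul mulM x y) = ev (fun p => ev (fun q => oapp h 0 (mulM p q)) y) x.
Proof.
have E (s : seq ((K * M) * (K * M))) : ev h (pmap (fun pq =>
          omap (fun m => (pq.1.1 * pq.2.1, m)) (mulM pq.1.2 pq.2.2)) s) =
    \sum_(pq <- s) (pq.1.1 * pq.2.1) *: oapp h 0 (mulM pq.1.2 pq.2.2).
  elim: s => [|pq s IH]; first by rewrite big_nil ev_nil.
  rewrite big_cons /= -IH; case: (mulM _ _) => [m|] /=.
    by rewrite ev_cons.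
  by rewrite scaler0 add0r.
rewrite E big_allpairs; apply: eq_bigr => p _.
by rewrite scaler_sumr; apply: eq_bigr => q _; rewrite scalerA.
Qed.

Lemma ev_lcmul_morph (B : algType K) (h : M -> B) x y :
  (forall p q, oapp h 0 (mulM p q) = h p * h q) ->
  ev h (lcmul mulM x y) = ev h x * ev h y.
Proof.
move=> hM; rewrite ev_lcmul {2}/ev mulr_suml; apply: eq_bigr => p _.
rewrite -scalerAl /ev mulr_sumr; congr (_ *: _); apply: eq_bigr => q _.
by rewrite hM scalerAr.
Qed.

Lemma lceq_lcmul x x' y y' : lceq x x' -> lceq y y' ->
  lceq (lcmul mulM x y) (lcmul mulM x' y').
Proof.
move=> ex ey; apply: ev_lceq => h; rewrite !ev_lcmul (lceq_ev _ ex).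
by apply: eq_ev => p; apply: lceq_ev.
Qed.

Hypothesis mulMA : forall p q r,
  obind (fun m => mulM m r) (mulM p q) = obind (mulM p) (mulM q r).

Lemma lcmulA x y z :
  lceq (lcmul mulM (lcmul mulM x y) z) (lcmul mulM x (lcmul mulM y z)).
Proof.
apply: ev_lceq => h; rewrite !ev_lcmul.
apply: eq_ev => p; rewrite ev_lcmul; apply: eq_ev => q.
transitivity (ev (fun r => oapp h 0 (obind (fun m => mulM m r) (mulM p q))) z).
  by case: (mulM p q) => //=; rewrite ev0.
by apply: eq_ev => r; rewrite mulMA; case: (mulM q r).
Qed.

Variable G : lc K M -> Prop.
Notation I := (in_ideal mulM G).

Lemma ideal_lceq x y : lceq x y -> I x -> I y.
Proof. by move=> e [s [sG xE]]; exists s; split=> // m; rewrite -e. Qed.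

Lemma ideal_nil : I [::].
Proof. by exists [::]; split. Qed.

Lemma ideal_gen x g y : G g -> I (lcmul mulM (lcmul mulM x g) y).
Proof.
move=> Gg; exists [:: (x, g, y)]; split=> [t|]; first by rewrite inE => /eqP ->.
by move=> m; rewrite /= /lcsum /= cats0.
Qed.

Lemma ideal_cat x y : I x -> I y -> I (x ++ y).
Proof.
move=> [s [sG xE]] [t [tG yE]]; exists (s ++ t); split=> [r|].
  by rewrite mem_cat => /orP [/sG|/tG].
apply: ev_lceq => h; rewrite map_cat !ev_cat !ev_lcsum big_cat /=.
by rewrite -!ev_lcsum (lceq_ev h xE) (lceq_ev h yE).
Qed.

(** Induction principle that hides the list of triples witnessing membership in the ideal. *)
Lemma ideal_ind (P : lc K M -> Prop) :
  (forall x y, lceq x y -> P x -> P y) -> P [::] ->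
  (forall x y, P x -> P y -> P (x ++ y)) ->
  (forall x g y, G g -> P (lcmul mulM (lcmul mulM x g) y)) ->
  forall x, I x -> P x.
Proof.
move=> Pe P0 PD PG x [s [sG xE]].
apply: (Pe (lcsum [seq lcmul mulM (lcmul mulM t.1.1 t.1.2) t.2 | t <- s])).
  by move=> m; rewrite xE.
elim: s sG {xE} => [|t s IH] sG //=; apply: (PD).
  by apply: PG; apply: sG; rewrite inE eqxx.
by apply: IH => r rs; apply: sG; rewrite inE rs orbT.
Qed.

Lemma lceq_sym x y : lceq x y -> lceq y x. Proof. by move=> e m. Qed.
Lemma lceq_trans y x z : lceq x y -> lceq y z -> lceq x z.
Proof. by move=> e e' m; rewrite e. Qed.

Lemma ideal_mull z x : I x -> I (lcmul mulM z x).
Proof.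
move: x; apply: ideal_ind.
- by move=> x y e; apply: ideal_lceq; apply: lceq_lcmul.
- apply: ideal_lceq ideal_nil; apply: ev_lceq => h.
  by rewrite ev_lcmul ev_nil (eq_ev _ (h' := fun=> 0)) ?ev0 // => p; rewrite ev_nil.
- move=> x y Ix Iy; apply: ideal_lceq (ideal_cat Ix Iy); apply: ev_lceq => h.
  rewrite ev_cat !ev_lcmul -ev_add; apply: eq_ev => p.
  by rewrite ev_cat.
- move=> x g y Gg; apply: ideal_lceq (ideal_gen (lcmul mulM z x) y Gg).
  apply: lceq_trans (lcmulA _ _ _).
  by apply: lceq_lcmul => //; apply: lcmulA.
Qed.

Lemma ideal_mulr z x : I x -> I (lcmul mulM x z).
Proof.
move: x; apply: ideal_ind.
- by move=> x y e; apply: ideal_lceq; apply: lceq_lcmul.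
- by apply: ideal_lceq ideal_nil; apply: ev_lceq => h.
- move=> x y Ix Iy; apply: ideal_lceq (ideal_cat Ix Iy); apply: ev_lceq => h.
  by rewrite ev_cat !ev_lcmul -ev_cat.
- move=> x g y Gg; apply: ideal_lceq (ideal_gen x (lcmul mulM y z) Gg).
  by apply: lceq_sym; apply: lcmulA.
Qed.

Lemma ideal_scale c x : I x -> I (lcscale c x).
Proof.
move: x; apply: ideal_ind.
- move=> x y e; apply: ideal_lceq; apply: ev_lceq => h.
  by rewrite !ev_scale (lceq_ev h e).
- exact: ideal_nil.
- by move=> x y Ix Iy; rewrite /lcscale map_cat; apply: ideal_cat.
- move=> x g y Gg; apply: ideal_lceq (ideal_gen (lcscale c x) y Gg).
  by apply: ev_lceq => h; rewrite ev_scale !ev_lcmul ev_scale.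
Qed.

Lemma ideal_sub x y : I x -> I y -> I (lcsub x y).
Proof. by move=> Ix Iy; apply: ideal_cat => //; apply: ideal_scale. Qed.

(** For a form [h] that is only linear, by bilinearity it is enough to test generators multiplied on
    both sides by basis elements. *)
Lemma ev_ideal (V : lmodType K) (h : M -> V) x :
  (forall g p q, G g ->
     ev (fun m => oapp (fun k => oapp h 0 (mulM k q)) 0 (mulM p m)) g = 0) ->
  I x -> ev h x = 0.
Proof.
move=> hG; move: x; apply: ideal_ind.
- by move=> x y e <-; rewrite (lceq_ev h e).
- exact: ev_nil.
- by move=> x y; rewrite ev_cat => -> ->; rewrite addr0.
- move=> x g y Gg; rewrite !ev_lcmul -[RHS](ev0 V x); apply: eq_ev => p.
  transitivity (ev (fun q => ev (fun m =>
      oapp (fun k => oapp h 0 (mulM k q)) 0 (mulM p m)) g) y).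
    rewrite /ev; under eq_bigr => m _.
      have -> : oapp (fun p0 : M => \sum_(p1 <- y) p1.1 *: oapp h 0 (mulM p0 p1.2)) 0
          (mulM p m.2) = \sum_(q <- y) q.1 *:
          oapp (fun k => oapp h 0 (mulM k q.2)) 0 (mulM p m.2).
        case: (mulM p m.2) => //=.
        by rewrite big1 // => q _; rewrite scaler0.
      rewrite scaler_sumr; over.
    rewrite exchange_big; apply: eq_bigr => q _; rewrite scaler_sumr.
    by apply: eq_bigr => m _; rewrite !scalerA mulrC.
  by rewrite -[RHS](ev0 V y); apply: eq_ev => q; apply: hG.
Qed.

Lemma ev_ideal_morph (B : algType K) (h : M -> B) x :
  (forall p q, oapp h 0 (mulM p q) = h p * h q) ->
  (forall g, G g -> ev h g = 0) -> I x -> ev h x = 0.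
Proof.
move=> hM hG; move: x; apply: ideal_ind.
- by move=> x y e <-; rewrite (lceq_ev h e).
- exact: ev_nil.
- by move=> x y; rewrite ev_cat => -> ->; rewrite addr0.
- by move=> x g y Gg; rewrite !ev_lcmul_morph // (hG g) // mulr0 mul0r.
Qed.

End LinearExtension.

(** * Evaluation of words at a pair (d, u), and the down-up relations *)

Section Words.
Variables (K : fieldType) (B : algType K).

Definition wprod (d u : B) (w : word) : B := \prod_(x <- w) (if x then u else d).

Lemma wprod_nil d u : wprod d u [::] = 1.
Proof. by rewrite /wprod big_nil. Qed.

Lemma wprod_cons d u x w : wprod d u (x :: w) = (if x then u else d) * wprod d u w.
Proof. by rewrite /wprod big_cons. Qed.

Lemma wprodM d u p q : oapp (wprod d u) 0 (wmul p q) = wprod d u p * wprod d u q.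
Proof. by rewrite /= /wprod big_cat. Qed.

Variables (a b g : K).

Definition du_sat (d u : B) :=
  d * d * u = a *: (d * u * d) + b *: (u * d * d) + g *: d /\
  d * u * u = a *: (u * d * u) + b *: (u * u * d) + g *: u.

Lemma ev_du_rel1 (V : lmodType K) (h : word -> V) : ev h (du_rel1 a b g) =
  h [:: dL; dL; uL] - (a *: h [:: dL; uL; dL] + b *: h [:: uL; dL; dL] + g *: h [:: dL]).
Proof.
rewrite /du_rel1 !ev_cons ev_nil addr0 !scaleNr scale1r /=.
by rewrite !opprD !addrA.
Qed.

Lemma ev_du_rel2 (V : lmodType K) (h : word -> V) : ev h (du_rel2 a b g) =
  h [:: dL; uL; uL] - (a *: h [:: uL; dL; uL] + b *: h [:: uL; uL; dL] + g *: h [:: uL]).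
Proof.
rewrite /du_rel2 !ev_cons ev_nil addr0 !scaleNr scale1r /=.
by rewrite !opprD !addrA.
Qed.

Lemma du_satP d u : du_sat d u <->
  (ev (wprod d u) (du_rel1 a b g) = 0 /\ ev (wprod d u) (du_rel2 a b g) = 0).
Proof.
rewrite ev_du_rel1 ev_du_rel2 !wprod_cons !wprod_nil /= !mulr1 !mulrA.
split=> [[-> ->]|[/eqP + /eqP]]; first by rewrite !subrr.
by rewrite !subr_eq0 => /eqP ? /eqP ?.
Qed.

Lemma ev_du_ideal d u x : du_sat d u -> du_ideal a b g x -> ev (wprod d u) x = 0.
Proof.
move=> /du_satP [e1 e2]; apply: ev_ideal_morph; first exact: wprodM.
by move=> r [] ->.
Qed.

End Words.

(** * Path algebras and the map from words to paths *)

Section Paths.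
Variables (n : nat) (E : eqType) (src tgt : E -> 'I_n).
Notation path := (qpath n E).
Notation mulp := (pmul src tgt).

Lemma valid_from_cat v (s t : seq E) : valid_from src tgt v (s ++ t) =
  valid_from src tgt v s && valid_from src tgt (pend tgt (v, s)) t.
Proof.
elim: s v => [|x s IH] v //=.
by rewrite IH andbA.
Qed.

Lemma valid_pmul p q r : mulp p q = Some r -> valid src tgt r.
Proof.
rewrite /pmul; case: ifP => // /andP [/andP [vp vq] /eqP e] [<-].
rewrite /valid /= valid_from_cat; case: p q e vp vq => [v s] [w t] /= e.
by rewrite /valid /= => -> ; rewrite e.
Qed.

Lemma pend_cat v (s t : seq E) : pend tgt (v, s ++ t) = pend tgt (pend tgt (v, s), t).
Proof. by rewrite /pend /= map_cat last_cat. Qed.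

Lemma pmulA p q r :
  obind (fun m => mulp m r) (mulp p q) = obind (mulp p) (mulp q r).
Proof.
case: p q r => [u s] [v t] [w z].
rewrite /pmul /=.
have [vp|] /= := boolP (valid src tgt (u, s)); last first.
  by move=> _; case: ifP => //=.
have [vq|] /= := boolP (valid src tgt (v, t)); last first.
  by rewrite /= => _.
have [vr|] /= := boolP (valid src tgt (w, z)); last first.
  by move=> h; case: ifP => //= _; rewrite andbF.
have [e1|n1] /= := eqVneq (pend tgt (u, s)) v.
  have -> : valid src tgt (u, s ++ t) by rewrite /valid /= valid_from_cat e1; apply/andP.
  rewrite pend_cat e1.
  have [e2|n2] //= := eqVneq (pend tgt (v, t)) w.
  have -> : valid src tgt (v, t ++ z) by rewrite /valid /= valid_from_cat e2; apply/andP.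
  by rewrite eqxx /= catA.
by case: ifP => //= _; rewrite (negbTE n1) andbF.
Qed.

Variable K : fieldType.
Notation lcp := (lc K path).
Notation mulq := (lcmul mulp).
Notation KQ := (@in_KQ n E src tgt K).
Notation one := (qunit n E K).

Lemma ev_qunit (V : lmodType K) (h : path -> V) : ev h one = \sum_v h (v, [::]).
Proof.
rewrite /qunit /ev big_map big_enum /=.
by apply: eq_bigr => v _; rewrite scale1r.
Qed.

Lemma eq_ev_KQ (V : lmodType K) (h h' : path -> V) (x : lcp) : KQ x ->
  (forall p, valid src tgt p -> h p = h' p) -> ev h x = ev h' x.
Proof.
move=> xK e; rewrite /ev big_seq [RHS]big_seq; apply: eq_bigr => p px.
by rewrite e //; move/allP: xK; apply.
Qed.

Lemma KQ_mul (x y : lcp) : KQ (mulq x y).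
Proof.
rewrite /in_KQ /lcmul all_pmap; apply/allP => pq _ /=.
by case e: (mulp _ _) => [m|] //=; apply: valid_pmul e.
Qed.

Lemma KQ_one : KQ one.
Proof. by apply/allP => p /mapP [v _ ->]. Qed.

(** Exactly one trivial path composes with a given valid path. An invalid raw path has product
    [None] with everything, hence the restriction to [KQ]. *)
Lemma mul1q (x : lcp) : KQ x -> lceq (mulq one x) x.
Proof.
move=> xK; apply: ev_lceq => h; rewrite ev_lcmul ev_qunit.
transitivity (ev (fun q => \sum_v oapp h 0 (mulp (v, [::]) q)) x).
  rewrite /ev exchange_big; apply: eq_bigr => q _; by rewrite scaler_sumr.
apply: eq_ev_KQ => // q vq; rewrite (bigD1 q.1) //= big1 => [|v /negbTE nv].
  by rewrite /pmul vq eqxx /= addr0; case: (q).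
by rewrite /pmul vq /= [pend _ _]/= /pend /= nv.
Qed.

Lemma mulq1 (x : lcp) : KQ x -> lceq (mulq x one) x.
Proof.
move=> xK; apply: ev_lceq => h; rewrite ev_lcmul.
apply: eq_ev_KQ => // p vp; rewrite ev_qunit.
rewrite (bigD1 (pend tgt p)) //= big1 => [|v /negbTE nv].
  by rewrite /pmul vp eqxx /= addr0 cats0; case: (p).
by rewrite /pmul vp /= eq_sym nv.
Qed.

Variables D U : lcp.
Notation img := (word_img src tgt D U).
Notation F := (free_to_KQ src tgt D U).

Lemma KQ_img w : KQ (img w).
Proof. by case: w => [|x w] /=; [apply: KQ_one | apply: KQ_mul]. Qed.

Lemma ev_F (V : lmodType K) (h : path -> V) x :
  ev h (F x) = ev (fun w => ev h (img w)) x.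
Proof.
rewrite /free_to_KQ ev_lcsum big_map; apply: eq_bigr => p _.
by rewrite ev_scale.
Qed.

Lemma img_cat v w : lceq (img (v ++ w)) (mulq (img v) (img w)).
Proof.
elim: v => [|x v IH] /=; first by apply: lceq_sym; apply: mul1q; apply: KQ_img.
apply: lceq_trans (lceq_sym (lcmulA pmulA _ _ _)).
by apply: lceq_lcmul.
Qed.

Lemma F_mul x y : lceq (F (lcmul wmul x y)) (mulq (F x) (F y)).
Proof.
apply: ev_lceq => h; rewrite ev_F !ev_lcmul ev_F; apply: eq_ev => v.
transitivity (ev (fun w => ev h (mulq (img v) (img w))) y).
  by apply: eq_ev => w; apply: lceq_ev; apply: img_cat.
transitivity (ev (fun w => ev (fun p => ev (fun q => oapp h 0 (mulp p q)) (img w)) (img v)) y).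
  by apply: eq_ev => w; rewrite ev_lcmul.
transitivity (ev (fun p => ev (fun w => ev (fun q => oapp h 0 (mulp p q)) (img w)) y) (img v)).
  rewrite /ev; under eq_bigr => w _ do rewrite scaler_sumr.
  rewrite exchange_big /=; apply: eq_bigr => p _; rewrite scaler_sumr.
  by apply: eq_bigr => w _; rewrite !scalerA mulrC.
by apply: eq_ev => p; rewrite ev_F.
Qed.

Lemma F_sub x y : lceq (F (lcsub x y)) (lcsub (F x) (F y)).
Proof. by apply: ev_lceq => h; rewrite ev_sub !ev_F ev_sub. Qed.

(** [word_img] ends every product with the unit, which is neutral only on valid paths. *)
Lemma F_letter x : KQ D -> KQ U -> lceq (F [:: (1, [:: x])]) (if x then U else D).
Proof.
move=> DK UK; apply: ev_lceq => h; rewrite ev_F ev1 /=.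
by apply: lceq_ev; apply: mulq1; case: x.
Qed.

Lemma F_nil : lceq (F [:: (1, [::])]) one.
Proof. by apply: ev_lceq => h; rewrite ev_F ev1. Qed.

(** The default 0 requires the images of two paths that do not compose to have product zero;
    [ev phi] is then multiplicative. *)
Definition path_morph (B : algType K) (phi : path -> B) :=
  forall p q, oapp phi 0 (mulp p q) = phi p * phi q.

Lemma ev_F_morph (B : algType K) (phi : path -> B) x :
  path_morph phi -> \sum_v phi (v, [::]) = 1 ->
  ev phi (F x) = ev (wprod (ev phi D) (ev phi U)) x.
Proof.
move=> phiM phi1; rewrite ev_F; apply: eq_ev; elim=> [|l w IH] /=.
  by rewrite ev_qunit phi1 wprod_nil.
by rewrite ev_lcmul_morph // IH wprod_cons; case: l.
Qed.

End Paths.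

(** * Evaluation of words at polynomials *)

Section Polynomials.
Variable K : fieldType.
Implicit Types (d u p q Z : {poly K}) (l : lc K word).

Lemma ev_wprod_comp d u q l :
  ev (wprod d u) l \Po q = ev (wprod (d \Po q) (u \Po q)) l.
Proof.
rewrite (@ev_additive K word _ _ (wprod d u) (comp_poly q)); apply: eq_ev => w.
by rewrite /= /wprod rmorph_prod; apply: eq_bigr => x _; case: x.
Qed.

(** Polynomials without linear term form a subalgebra, the coordinate ring of the cusp. *)
Lemma coef1_ev_wprod d u l : d`_1 = 0 -> u`_1 = 0 -> (ev (wprod d u) l)`_1 = 0.
Proof.
move=> d1 u1; apply: (@ev_closed _ _ _ (fun p : {poly K} => p`_1 = 0)).
- by rewrite coef0.
- by move=> c p q p1 q1; rewrite coefD coefZ p1 q1 mulr0 addr0.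
elim=> [|x w IH]; first by rewrite wprod_nil coef1.
rewrite wprod_cons coefM big_ord_recl big_ord_recl big_ord0 /= IH addr0 mulr0 add0r.
by case: x; rewrite ?d1 ?u1 mul0r.
Qed.

Lemma ev_wprod_const d u l : (size d <= 1)%N -> (size u <= 1)%N ->
  ev (wprod d u) l <> 'X.
Proof.
move=> /size1_polyC -> /size1_polyC -> e.
(* Substituting 0 fixes constants, hence everything they generate, but it moves ['X] to 0. *)
have := ev_wprod_comp (d`_0)%:P (u`_0)%:P 0 l.
rewrite !comp_polyC e comp_polyX => /eqP.
by rewrite eq_sym polyX_eq0.
Qed.

(* [Z] would have degree dividing both 2 and 3. *)
Lemma cusp_not_monogenic p q Z :
  p \Po Z = 'X^2 -> q \Po Z = 'X^3 -> Z`_1 = 0 -> False.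
Proof.
move=> e2 e3 Z1.
have := size_comp_poly p Z; rewrite e2 size_polyXn /= => /esym s2.
have := size_comp_poly q Z; rewrite e3 size_polyXn /= => /esym s3.
have : ((size Z).-1 %| gcdn 2 3)%N.
  by rewrite dvdn_gcd -[X in (_ %| X)%N]s2 -[X in _ && (_ %| X)%N]s3 !dvdn_mull.
rewrite dvdn1 => /eqP sZ.
have Z0 : Z != 0 by apply/eqP => z; move: sZ; rewrite z size_poly0.
have : lead_coef Z != 0 by rewrite lead_coef_eq0.
by rewrite lead_coefE sZ Z1 eqxx.
Qed.

(** When one of the two vanishes, the subalgebra generated consists of the polynomials in the other
    one, which cannot contain both ['X^2] and ['X^3]. *)
Lemma cusp_not_wprod d u l2 l3 : d`_1 = 0 -> u`_1 = 0 -> d = 0 \/ u = 0 ->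
  ev (wprod d u) l2 = 'X^2 -> ev (wprod d u) l3 = 'X^3 -> False.
Proof.
move=> d1 u1 [] -> e2 e3.
  apply: (@cusp_not_monogenic (ev (wprod 0 'X) l2) (ev (wprod 0 'X) l3) u) => //;
  by rewrite ev_wprod_comp comp_polyX comp_poly0.
apply: (@cusp_not_monogenic (ev (wprod 'X 0) l2) (ev (wprod 'X 0) l3) d) => //;
by rewrite ev_wprod_comp comp_polyX comp_poly0.
Qed.

Lemma coef_ev (M : eqType) (h : M -> {poly K}) k (m : M) (x : lc K M) :
  (forall t, (h t)`_k = (t == m)%:R) -> (ev h x)`_k = coef x m.
Proof.
move=> e; rewrite coef_sum_indicator coef_sum; apply: eq_bigr => p _.
by rewrite coefZ e.
Qed.

(** Modulo ['X] only the empty word survives. *)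
Lemma coef0_ev_wprod d u l : d`_0 = 0 -> u`_0 = 0 ->
  (ev (wprod d u) l)`_0 = coef l [::].
Proof.
move=> d0 u0; apply: coef_ev => -[|x w]; first by rewrite wprod_nil coef1.
by rewrite wprod_cons coefM big_ord_recl big_ord0 /=; case: x; rewrite ?d0 ?u0 mul0r addr0.
Qed.

(** Words containing [uL] are killed and a power of [dL] becomes the same power of ['X], so the
    linear coefficient isolates the single letter. *)
Lemma coef1_ev_wprodX0 l : (ev (wprod 'X 0) l)`_1 = coef l [:: dL].
Proof.
apply: coef_ev => -[|x w]; first by rewrite wprod_nil coef1.
rewrite wprod_cons; case: x => /=; first by rewrite mul0r coef0.
rewrite coefXM /=; case: w => [|y w]; first by rewrite wprod_nil coef1.
by rewrite wprod_cons; case: y => /=; rewrite ?mul0r ?coef0 ?coefXM.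
Qed.

Lemma coef1_ev_wprod0X l : (ev (wprod 0 'X) l)`_1 = coef l [:: uL].
Proof.
apply: coef_ev => -[|x w]; first by rewrite wprod_nil coef1.
rewrite wprod_cons; case: x => /=; last by rewrite mul0r coef0.
rewrite coefXM /=; case: w => [|y w]; first by rewrite wprod_nil coef1.
by rewrite wprod_cons; case: y => /=; rewrite ?mul0r ?coef0 ?coefXM.
Qed.

End Polynomials.

(** * Upper triangular matrices of size 4 *)

Section Matrices.
Variable K : fieldType.
Notation M4 := 'M[K]_4.

(** The filtration by superdiagonals: [upper 0] is triangular, [upper 1] strictly triangular, and
    degrees add under products. *)
Definition upper (k : nat) (A : M4) := forall i j : 'I_4, (j < i + k)%N -> A i j = 0.

Lemma upperW k l A : (l <= k)%N -> upper k A -> upper l A.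
Proof. by move=> lk Au i j ij; apply: Au; apply: leq_trans ij _; rewrite leq_add2l. Qed.

Lemma upper0 k : upper k 0.
Proof. by move=> i j _; rewrite mxE. Qed.

Lemma upper_lin k c A B : upper k A -> upper k B -> upper k (c *: A + B).
Proof. by move=> Au Bu i j ij; rewrite !mxE Au // Bu // mulr0 addr0. Qed.

Lemma upperM k l A B : upper k A -> upper l B -> upper (k + l) (A * B).
Proof.
move=> Au Bu i j ij; rewrite mxE big1 // => m _.
have [mi|im] := ltnP m (i + k); first by rewrite Au // mul0r.
rewrite [B _ _]Bu ?mulr0 //; apply: leq_trans ij _.
by rewrite addnA leq_add2r.
Qed.

Lemma upper_prod (T : Type) (f : T -> M4) (s : seq T) :
  (forall x, upper 0 (f x)) -> upper 0 (\prod_(x <- s) f x).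
Proof.
move=> fu; elim: s => [|x s IH]; last by rewrite big_cons; apply: (@upperM 0 0).
rewrite big_nil => i j; rewrite addn0 -[1]/(1%:M) mxE.
by case: eqP => // ->; rewrite ltnn.
Qed.

(** With elementary matrices indexed from 0, [P4] is e01 + e12 and [Q4] is e23, so that P4 P4 Q4 =
    e03. *)
Definition P4 : M4 := \matrix_(i, j) ((i < 2) && (j == i.+1 :> nat))%N%:R.
Definition Q4 : M4 := \matrix_(i, j) ((i == 2 :> nat) && (j == 3 :> nat))%N%:R.

Lemma upper_P4 : upper 1 P4.
Proof.
move=> i j; rewrite addn1 ltnS => ij; rewrite mxE.
by case: eqP ij => [->|_ _]; rewrite ?ltnn // andbF.
Qed.

Lemma upper_Q4 : upper 1 Q4.
Proof.
move=> i j; rewrite addn1 ltnS => ij; rewrite mxE.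
by case: eqP ij => // -> ; case: eqP => // ->.
Qed.

Let o0 : 'I_4 := @Ordinal 4 0 isT.
Let o1 : 'I_4 := @Ordinal 4 1 isT.
Let o2 : 'I_4 := @Ordinal 4 2 isT.
Let o3 : 'I_4 := @Ordinal 4 3 isT.

Lemma mul4E (A B : M4) i j : (A * B) i j =
  A i o0 * B o0 j + A i o1 * B o1 j + A i o2 * B o2 j + A i o3 * B o3 j.
Proof.
rewrite mxE !big_ord_recl big_ord0 addr0 !addrA.
by congr (_ + _ + _ + _); congr (A _ _ * B _ _); apply: val_inj.
Qed.

Let o4P (P : 'I_4 -> Prop) : P o0 -> P o1 -> P o2 -> P o3 -> forall i, P i.
Proof.
move=> P0 P1 P2 P3 [[|[|[|[|//]]]] hi].
- by have -> : Ordinal hi = o0 by apply: val_inj.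
- by have -> : Ordinal hi = o1 by apply: val_inj.
- by have -> : Ordinal hi = o2 by apply: val_inj.
- by have -> : Ordinal hi = o3 by apply: val_inj.
Qed.

Lemma mulQP4 : Q4 * P4 = 0.
Proof. by apply/matrixP; apply: (o4P); apply: (o4P); rewrite !mul4E !mxE /=; ring. Qed.

Lemma mulQQ4 : Q4 * Q4 = 0.
Proof. by apply/matrixP; apply: (o4P); apply: (o4P); rewrite !mul4E !mxE /=; ring. Qed.

Lemma mulPPP4 : P4 * (P4 * P4) = 0.
Proof. by apply/matrixP; apply: (o4P); apply: (o4P); rewrite !mul4E !mxE /=; ring. Qed.

(* Up to scalars, [P4] and [Q4] represent [x] and [y] in the algebra whose only
   nonzero monomials are the subwords of [xxy]. *)
Lemma prod_PQ4_neq0 (T : eqType) (h : T -> M4) (c c' : K) x y s :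
  h x = c *: P4 -> h y = c' *: Q4 -> (forall z, z != x -> z != y -> h z = 0) ->
  (2 <= size s)%N -> \prod_(z <- s) h z <> 0 ->
  [\/ s = [:: x; x], s = [:: x; y] | s = [:: x; x; y]].
Proof.
move=> hx hy h0.
have hyz z : h y * h z = 0.
  have [->|zx] := eqVneq z x; first by rewrite hx hy -scalerAl -scalerAr mulQP4 !scaler0.
  have [->|zy] := eqVneq z y; first by rewrite hy -scalerAl -scalerAr mulQQ4 !scaler0.
  by rewrite (h0 z) // mulr0.
have xxx : h x * (h x * h x) = 0.
  by rewrite hx -!(scalerAl, scalerAr) mulPPP4 !scaler0.
case: s => [|z [|t s]] // _; rewrite big_cons big_cons.
have [->|zx] := eqVneq z x; last first.
  have [->|zy] := eqVneq z y; first by rewrite mulrA hyz mul0r.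
  by rewrite h0 // mul0r.
have [->|tx] := eqVneq t x; last first.
  have [->|ty] := eqVneq t y; last by rewrite (h0 t) // mul0r mulr0.
  case: s => [_|w s]; first by constructor 2.
  by rewrite big_cons [h y * _]mulrA hyz mul0r mulr0.
case: s => [_|w s]; first by constructor 1.
rewrite big_cons; have [->|wx] := eqVneq w x.
  by rewrite !mulrA -[h x * h x * h x]mulrA xxx mul0r.
have [->|wy] := eqVneq w y; last by rewrite (h0 w) // mul0r !mulr0.
case: s => [_|w' s]; first by constructor 3.
by rewrite big_cons [h y * _]mulrA hyz mul0r !mulr0.
Qed.

(** If d0 = u0 = 0, entry (0,3) of the relation reads 1 = 0. If a + b = 1, the relation is d C + b C
    d = 0 with C = d u - u d; here C lies in [upper 2] with C02 = 0 and C13 = 1, so entry (1,3)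
    gives d0 (1 + b) = 0 and entry (0,3) gives 1 + d0 (1 + b) C03 = 0. *)
Lemma no_upper4 (a b d0 u0 : K) (d u : M4) :
  upper 2 (d - (d0%:M + P4)) -> upper 2 (u - (u0%:M + Q4)) ->
  d * d * u = a *: (d * u * d) + b *: (u * d * d) ->
  1 - a - b = 0 \/ d0 = 0 /\ u0 = 0 -> False.
Proof.
move=> du uu rel H.
have dE (i j : 'I_4) : (j < i + 2)%N -> d i j =
    d0 * (i == j :> nat)%:R + ((i < 2) && (j == i.+1 :> nat))%N%:R.
  by move=> /du /eqP; rewrite !mxE subr_eq0 mulr_natr => /eqP.
have uE (i j : 'I_4) : (j < i + 2)%N -> u i j =
    u0 * (i == j :> nat)%:R + ((i == 2 :> nat) && (j == 3 :> nat))%N%:R.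
  by move=> /uu /eqP; rewrite !mxE subr_eq0 mulr_natr => /eqP.
have addE (A B : M4) i j : (A + B) i j = A i j + B i j by rewrite mxE.
have scE c (A : M4) i j : (c *: A) i j = c * A i j by rewrite mxE.
have e03 := congr1 (fun M : M4 => M o0 o3) rel.
have e13 := congr1 (fun M : M4 => M o1 o3) rel.
rewrite /= addE !scE !mul4E in e03.
rewrite /= addE !scE !mul4E in e13.
(* Only the entries (0,2), (0,3) and (1,3) are left free by the conditions modulo [upper 2]. *)
pose simpE := (dE o0 o0, dE o0 o1, dE o1 o0, dE o1 o1, dE o1 o2, dE o2 o0, dE o2 o1,
  dE o2 o2, dE o2 o3, dE o3 o0, dE o3 o1, dE o3 o2, dE o3 o3).
pose simpE' := (uE o0 o0, uE o0 o1, uE o1 o0, uE o1 o1, uE o1 o2, uE o2 o0, uE o2 o1,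
  uE o2 o2, uE o2 o3, uE o3 o0, uE o3 o1, uE o3 o2, uE o3 o3).
rewrite !simpE ?simpE' // in e03 e13.
move: e03 e13; rewrite /=.
move: (d o0 o2) (d o0 o3) (d o1 o3) (u o0 o2) (u o0 o3) (u o1 o3) => r02 r03 r13 s02 s03 s13.
move=> e03 e13.
have one0 : (1 : K) = 0; last by move/eqP: one0; rewrite oner_eq0.
case: H => [/eqP|[d00 u00]]; last first.
  move: e03; rewrite d00 u00 => /eqP; rewrite -subr_eq0 => /eqP <-; ring.
move=> /eqP ab; have aE : a = 1 - b by rewrite -[a]addr0 -ab; ring.
move: e03 e13; rewrite aE => /eqP; rewrite -subr_eq0 => /eqP e03 /eqP.
rewrite -subr_eq0 => /eqP e13.
(* The factor [s13 + r02] is the entry (0,3) of d u - u d; this combination of the two equations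
   equals 1. *)
have lc (x y : K) : x = 0 -> y = 0 -> x - (s13 + r02) * y = 0.
  by move=> -> ->; rewrite mulr0 subr0.
by rewrite -[RHS](lc _ _ e03 e13); ring.
Qed.
End Matrices.

(** * A linear form detecting the degree 3 part when g = 0 *)

Section CubicFunctional.
Variables (K : fieldType) (a b p q : K).

(* For [g = 0], a linear form on words of length 3 that vanishes on both relations. *)
Definition cubic (w : word) : K^o :=
  if w == [:: dL; dL; uL] then a * p + b * q
  else if w == [:: dL; uL; dL] then p
  else if w == [:: uL; dL; dL] then q else 0.

Lemma cubic_size w : size w != 3 -> cubic w = 0.
Proof. by rewrite /cubic; do 3 (case: (w =P _) => [->|_] //). Qed.

(** The relations are homogeneous of degree 3, so multiplying them by a nonempty word leaves the
    support of [cubic]. The value at ddu is what the first relation dictates, and the words of the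
    second relation lie outside the support. *)
Lemma cubic_du_ideal x : du_ideal a b 0 x -> ev cubic x = 0.
Proof.
apply: ev_ideal => r w w' /= [] ->; rewrite ?ev_du_rel1 ?ev_du_rel2 scale0r addr0.
- case: w => [|c w]; last by rewrite !cubic_size ?scaler0 ?addr0 ?subr0 //= !size_cat /= !addnS.
  case: w' => [|c w']; last by rewrite !cubic_size ?scaler0 ?addr0 ?subr0.
  by rewrite /cubic /= subrr.
- case: w => [|c w]; last by rewrite !cubic_size ?scaler0 ?addr0 ?subr0 //= !size_cat /= !addnS.
  case: w' => [|c w']; last by rewrite !cubic_size ?scaler0 ?addr0 ?subr0.
  by rewrite /cubic /= !scaler0 addr0 subrr.
Qed.

Lemma ev_split_word (h : word -> K^o) (l : lc K word) :
  ev h l = coef l [::] *: h [::] + coef l [:: dL] *: h [:: dL]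
    + coef l [:: uL] *: h [:: uL] + ev (fun w => if (2 <= size w)%N then h w else 0) l.
Proof.
have coefZ' (m : word) (c : K^o) : coef l m *: c = ev (fun m' => (m' == m)%:R *: c) l.
  rewrite coef_sum_indicator scaler_suml; apply: eq_bigr => t _.
  by rewrite scalerA.
rewrite !coefZ' -!ev_add; apply: eq_ev => -[|c [|c' w]] /=.
- by rewrite !scale0r !addr0 scale1r.
- by case: c; rewrite /= !scale0r ?add0r ?addr0 scale1r.
- by rewrite !eqseq_cons !andbF !scale0r !add0r.
Qed.

(** Here [l] starts with a multiple of d and [l'] with a multiple of u, so the only word of length 3
    in the product is ddu. *)
Lemma ev_cubic_mul3 (l l' : lc K word) :
  coef l [::] = 0 -> coef l [:: uL] = 0 -> coef l' [::] = 0 -> coef l' [:: dL] = 0 ->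
  ev cubic (lcmul wmul (lcmul wmul l l) l') =
  coef l [:: dL] * coef l [:: dL] * coef l' [:: uL] * (a * p + b * q).
Proof.
move=> l0 lu l'0 l'd; rewrite !ev_lcmul.
pose G w := ev (fun w' => cubic (w ++ w')) l'.
have GE w : (2 <= size w)%N -> G w = coef l' [:: uL] * cubic (w ++ [:: uL]).
  move=> sw; rewrite /G ev_split_word l'0 l'd !scale0r !add0r.
  rewrite (eq_ev _ (h' := fun=> 0)) ?ev0 ?addr0 // => w'; case: ifP => // sw'.
  by rewrite cubic_size // size_cat gtn_eqF // (leq_add sw sw').
have GE0 w : (3 <= size w)%N -> G w = 0.
  move=> sw; rewrite GE ?(ltnW sw) // cubic_size ?mulr0 // size_cat gtn_eqF //.
  by rewrite addn1 ltnS.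
pose T w := ev (fun w' => G (w ++ w')) l.
transitivity (ev T l); first exact: eq_ev.
have inner w : (1 <= size w)%N -> T w = coef l [:: dL] * G (w ++ [:: dL]).
  move=> sw; rewrite /T ev_split_word l0 lu !scale0r add0r addr0.
  rewrite (eq_ev _ (h' := fun=> 0)) ?ev0 ?addr0 // => w'; case: ifP => // sw'.
  by rewrite GE0 // size_cat (leq_add sw sw').
rewrite ev_split_word l0 lu !scale0r add0r addr0.
rewrite (eq_ev _ (h' := fun=> 0)) ?ev0 ?addr0 => [|w].
  by rewrite inner // GE //= /cubic /= /GRing.scale /= !mulrA.
case: ifP => // sw; rewrite inner ?(ltnW sw) // GE0 ?mulr0 // size_cat addn1 ltnS.
exact: sw.
Qed.

End CubicFunctional.

(** * A presentation of A as KQ/I with I generated by paths, and its representations *)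

Section MonomialPresentation.
Variables (K : fieldType) (a b g : K) (n : nat) (E : eqType) (src tgt : E -> 'I_n).
Variables (Gp : qpath n E -> Prop) (D U : lc K (qpath n E)).
Notation path := (qpath n E).
Notation mulp := (pmul src tgt).
Notation mulq := (lcmul mulp).
Notation F := (free_to_KQ src tgt D U).
Notation I := (@path_ideal n E src tgt K Gp).
Notation J := (du_ideal a b g).
Hypothesis Gp_long : forall p, Gp p -> valid src tgt p /\ (2 <= plen p)%N.
Hypotheses (D_KQ : in_KQ src tgt D) (U_KQ : in_KQ src tgt U).
Hypothesis F_surj : forall y : lc K path, in_KQ src tgt y ->
  exists x : lc K word, I (lcsub y (F x)).
Hypothesis F_ker : forall x : lc K word, I (F x) <-> J x.

(* Meaningful modulo [J] only; invalid raw paths, which are zero in KQ, lift to 0. *)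
Definition lift (p : path) : lc K word :=
  if valid src tgt p then
    epsilon (inhabits [::]) (fun x => I (lcsub [:: (1, p)] (F x)))
  else [::].

Lemma lift_invalid p : valid src tgt p = false -> lift p = [::].
Proof. by rewrite /lift => ->. Qed.

Lemma liftP p : valid src tgt p -> I (lcsub [:: (1, p)] (F (lift p))).
Proof.
move=> vp; rewrite /lift vp; apply: (epsilon_spec (inhabits [::])
  (fun x => I (lcsub [:: (1, p)] (F x)))).
by apply: F_surj; rewrite /in_KQ /= vp.
Qed.

Lemma lifts_cong y x x' : I (lcsub y (F x)) -> I (lcsub y (F x')) -> J (lcsub x x').
Proof.
move=> h h'; apply/F_ker; apply: ideal_lceq (ideal_sub h' h).
apply: ev_lceq => k; rewrite (lceq_ev k (F_sub _ _ _ _ _ _)) !ev_sub.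
by rewrite opprB addrC addrA subrK.
Qed.

(** Writing X and X' for the images of [x] and [x'], use y y' - X X' = (y - X) y' + X (y' - X'). *)
Lemma lift_mul_gen y y' x x' : I (lcsub y (F x)) -> I (lcsub y' (F x')) ->
  I (lcsub (mulq y y') (F (lcmul wmul x x'))).
Proof.
move=> h h'.
have m := @pmulA n E src tgt.
apply: ideal_lceq (ideal_cat (ideal_mulr m y' h) (ideal_mull m (F x) h')).
apply: ev_lceq => k.
rewrite ev_cat ev_sub (lceq_ev k (F_mul _ _ _ _ _ _)) !ev_lcmul ev_sub.
under [X in _ + X]eq_ev => p do rewrite ev_sub -scaleN1r.
rewrite ev_add; set c := ev _ (F x).
have -> : ev (fun p => -1 *: ev (fun q => oapp k 0 (mulp p q)) (F x')) (F x) =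
   - ev (fun p => ev (fun q => oapp k 0 (mulp p q)) (F x')) (F x).
  rewrite /ev -sumrN; apply: eq_bigr => p _.
  by rewrite scaleN1r scalerN.
by rewrite addrA addrNK.
Qed.

(** The product of the three lifts is sent to the path [t] modulo I, and the preimage of I is J. *)
Lemma lift_mul3 p q r s t : mulp p q = Some s -> mulp s r = Some t ->
  I [:: (1, t)] -> J (lcmul wmul (lcmul wmul (lift p) (lift q)) (lift r)).
Proof.
move=> e1 e2 It.
have [vp vq] : valid src tgt p /\ valid src tgt q.
  by move: e1; rewrite /pmul; case: ifP => // /andP [/andP []].
have vr : valid src tgt r.
  by move: e2; rewrite /pmul; case: ifP => // /andP [/andP []].
have := lift_mul_gen (lift_mul_gen (liftP vp) (liftP vq)) (liftP vr) => H.
apply/F_ker; apply: ideal_lceq (ideal_sub It H).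
apply: ev_lceq => k; rewrite !ev_sub ev1 ev_lcmul /lcmul /= e1 /= ev_cons ev_nil.
by rewrite addr0 ev_cons ev_nil /= e2 /= !mulr1 !scale1r addr0 subKr.
Qed.

(** A unital representation of KQ/I in [B], recorded by its values on paths. *)
Definition mulrep (B : algType K) (phi : path -> B) :=
  [/\ path_morph src tgt phi, forall p, Gp p -> phi p = 0
    & \sum_v phi (v, [::]) = 1].

Lemma ev_path_ideal (B : algType K) (phi : path -> B) x :
  mulrep phi -> I x -> ev phi x = 0.
Proof.
move=> [phiM phiG _]; apply: ev_ideal_morph => // r [p [Gpp ->]].
by rewrite ev1 phiG.
Qed.

(** Multiply by 1, the sum of the images of the trivial paths: an invalid path has product [None]
    with each of them. *)
Lemma mulrep_invalid (B : algType K) (phi : path -> B) p :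
  mulrep phi -> valid src tgt p = false -> phi p = 0.
Proof.
move=> [phiM _ phi1] vp; rewrite -[phi p]mulr1 -phi1 mulr_sumr big1 // => v _.
by rewrite -phiM /pmul vp.
Qed.

Lemma mulrep_sat (B : algType K) (phi : path -> B) :
  mulrep phi -> du_sat a b g (ev phi D) (ev phi U).
Proof.
move=> H; have [phiM _ phi1] := H; apply/du_satP.
rewrite -!(ev_F_morph (src := src) (tgt := tgt) D U) //; split; apply: ev_path_ideal => //; apply/F_ker.
(* A relation lies in J as its own product with the empty word on both sides. *)
- apply: ideal_lceq (ideal_gen wmul [:: (1, [::])] [:: (1, [::])] (or_introl erefl)).
  apply: ev_lceq => k; rewrite !ev_lcmul ev1; apply: eq_ev => w.
  by rewrite /= ev1 /= cats0.
- apply: ideal_lceq (ideal_gen wmul [:: (1, [::])] [:: (1, [::])] (or_intror erefl)).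
  apply: ev_lceq => k; rewrite !ev_lcmul ev1; apply: eq_ev => w.
  by rewrite /= ev1 /= cats0.
Qed.

(** Surjectivity of the presentation: the images of D and U generate the image of every path. The
    contradictions below exhibit an arrow whose value escapes the algebra so generated. *)
Lemma mulrep_lift (B : algType K) (phi : path -> B) p :
  mulrep phi -> phi p = ev (wprod (ev phi D) (ev phi U)) (lift p).
Proof.
move=> H; have [phiM _ phi1] := H.
have [vp|vp] := boolP (valid src tgt p); last first.
  by rewrite lift_invalid ?(negbTE vp) // ev_nil (mulrep_invalid H) // (negbTE vp).
have := ev_path_ideal H (liftP vp); rewrite ev_sub ev1 => /eqP.
by rewrite subr_eq0 => /eqP ->; apply: ev_F_morph.
Qed.

(** * From a pair satisfying the relations to a representation of KQ/I *)

Section Pullback.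
Variables (B : algType K) (d u : B).
Hypothesis sat : du_sat a b g d u.
Definition pullback (p : path) : B := ev (wprod d u) (lift p).

Lemma pullback_cong y x x' : I (lcsub y (F x)) -> I (lcsub y (F x')) ->
  ev (wprod d u) x = ev (wprod d u) x'.
Proof.
move=> h h'; have := ev_du_ideal sat (lifts_cong h h').
by rewrite ev_sub => /eqP; rewrite subr_eq0 => /eqP.
Qed.

(** Lifting [y] term by term gives another lift of [y], and two lifts differ by an element of J,
    which evaluates to 0. *)
Lemma pullback_ev y x : in_KQ src tgt y -> I (lcsub y (F x)) ->
  ev pullback y = ev (wprod d u) x.
Proof.
move=> yK Iyx.
pose z := lcsum [seq lcscale p.1 (lift p.2) | p <- y].
have -> : ev pullback y = ev (wprod d u) z.
  by rewrite /z ev_lcsum big_map; apply: eq_bigr => p _; rewrite ev_scale.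
apply: pullback_cong Iyx; rewrite /z {z}.
elim: y yK => [|[c p] y IH] /= yK.
  exact: ideal_nil.
have [vp yK'] := andP yK.
apply: ideal_lceq (ideal_cat (ideal_scale c (liftP vp)) (IH yK')).
apply: ev_lceq => k.
rewrite ev_cat ev_scale !ev_sub ev1 ev_cons /= !ev_F /lcsum /= ev_cat ev_scale.
by rewrite scalerBr opprD addrACA.
Qed.

Lemma pullback_D : ev pullback D = d.
Proof.
rewrite (@pullback_ev D [:: (1, [:: dL])]) //.
  by rewrite ev1 wprod_cons wprod_nil mulr1.
apply: ideal_lceq (ideal_nil _ _); apply: ev_lceq => k.
by rewrite ev_sub (lceq_ev k (F_letter dL D_KQ U_KQ)) subrr ev_nil.
Qed.

Lemma pullback_U : ev pullback U = u.
Proof.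
rewrite (@pullback_ev U [:: (1, [:: uL])]) //.
  by rewrite ev1 wprod_cons wprod_nil mulr1.
apply: ideal_lceq (ideal_nil _ _); apply: ev_lceq => k.
by rewrite ev_sub (lceq_ev k (F_letter uL D_KQ U_KQ)) subrr ev_nil.
Qed.

Lemma pullback_mulrep : mulrep pullback.
Proof.
split.
- move=> p q; rewrite /pullback.
  have [vp|vp] := boolP (valid src tgt p); last first.
    by rewrite /pmul (negbTE vp) /= lift_invalid ?(negbTE vp) // ev_nil mul0r.
  have [vq|vq] := boolP (valid src tgt q); last first.
    rewrite /pmul (negbTE vq) andbF /= [lift q]lift_invalid ?(negbTE vq) //.
    by rewrite ev_nil mulr0.
  rewrite -(ev_lcmul_morph (mulM := wmul)); last exact: wprodM.
  have := lift_mul_gen (liftP vp) (liftP vq).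
  rewrite {1}/lcmul /=; case e: (mulp p q) => [r|] /= H.
    apply: pullback_cong (liftP (valid_pmul e)) _.
    by rewrite mulr1 in H.
  (* A zero product of paths is lifted by the product of the lifts and also by the empty
     combination. *)
  symmetry; rewrite -[RHS](ev_nil (wprod d u)); apply: pullback_cong H _.
  exact: ideal_nil.
- move=> p Gpp; have [vp _] := Gp_long Gpp.
  rewrite -(ev_nil (wprod d u)); apply: pullback_cong (liftP vp) _.
  (* A generator lies in I, so the empty combination lifts it. *)
  have -> : lcsub [:: (1 : K, p)] (F [::]) = [:: (1, p)] by [].
  have Gr : (fun r => exists p, Gp p /\ r = [:: (1 : K, p)]) [:: (1, p)] by exists p.
  apply: ideal_lceq (ideal_gen mulp [:: (1, (p.1, [::]))] (qunit n E K) Gr).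
  have pK : in_KQ src tgt [:: (1 : K, p)] by rewrite /in_KQ /= vp.
  apply: lceq_trans (mulq1 pK); apply: lceq_lcmul => //.
  apply: ev_lceq => k; rewrite ev_lcmul !ev1 /pmul vp /= eqxx /=.
  by case: (p).
- rewrite -ev_qunit (@pullback_ev _ [:: (1, [::])]) ?ev1 ?wprod_nil //.
    exact: (@KQ_one n E src tgt K).
  apply: ideal_lceq (ideal_nil _ _); apply: ev_lceq => k.
  by rewrite ev_sub (lceq_ev k (F_nil _ _ _ _)) subrr ev_nil.
Qed.

End Pullback.

(** * Representations supported on the loops at one vertex *)

Section LoopRep.
Variables (B : algType K) (v : 'I_n) (f : E -> B).

Definition rep (p : path) : B := if p.1 == v then \prod_(x <- p.2) f x else 0.

Hypothesis f_loop : forall x, f x <> 0 -> src x = v /\ tgt x = v.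

(** Arrows with nonzero value are loops at [v], so a sequence that is not a closed path at [v]
    contains an arrow of value 0. *)
Lemma rep_not_loop (s : seq E) :
  (valid_from src tgt v s && (pend tgt (v, s) == v)) = false ->
  \prod_(x <- s) f x = 0.
Proof.
elim: s => [|x s IH] /=; first by rewrite /pend /= eqxx.
rewrite big_cons; have [->|/eqP fx] := eqVneq (f x) 0; first by rewrite mul0r.
have [sx tx] := f_loop fx.
by rewrite sx eqxx tx /pend /= tx => /IH ->; rewrite mulr0.
Qed.

Lemma rep_mulrep : (forall p, Gp p -> rep p = 0) -> mulrep rep.
Proof.
move=> kG; split=> //; last first.
  rewrite (bigD1 v) //= big1 => [|w /negbTE nw]; last by rewrite /rep /= nw.
  by rewrite /rep /= eqxx big_nil addr0.
move=> [w s] [w' s']; rewrite /pmul /rep /=.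
have [ew|nw] := eqVneq w v; last by case: ifP => //= _; rewrite ?(negbTE nw) mul0r.
have [ew'|nw'] := eqVneq w' v; last first.
  rewrite mulr0 ew; case: ifP => //= /andP [/andP [_ _] /eqP e].
  rewrite eqxx big_cat /=; have -> : \prod_(x <- s) f x = 0; last by rewrite mul0r.
  by apply: rep_not_loop; rewrite e (negbTE nw') andbF.
rewrite ew ew'.
case: ifP => [_|] /=; first by rewrite eqxx big_cat.
move/negbT; rewrite !negb_and -orbA /valid /=.
case: (boolP (valid_from src tgt v s && (pend tgt (v, s) == v))) => [/andP [vs ps]|nb _].
  rewrite vs ps /= orbF => vs'; rewrite [X in _ * X]rep_not_loop ?mulr0 //.
  by rewrite (negbTE vs').
by rewrite rep_not_loop ?mul0r // (negbTE nb).
Qed.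

End LoopRep.

Lemma rep_e (B : algType K) v (f : E -> B) : rep v f (v, [::]) = 1.
Proof. by rewrite /rep eqxx big_nil. Qed.

Lemma rep_arrow (B : algType K) v (f : E -> B) x : rep v f (v, [:: x]) = f x.
Proof. by rewrite /rep eqxx big_seq1. Qed.

(** In a domain the orthogonal idempotents given by the trivial paths are 0 or 1, and they sum to 1,
    so exactly one is 1. Paths through any other vertex factor through 0, which leaves products of
    loops. *)
Lemma mulrep_domain (phi : path -> {poly K}) : mulrep phi ->
  exists v f, phi =1 rep v f /\ (forall x, f x <> 0 -> src x = v /\ tgt x = v).
Proof.
move=> H; have [phiM phiG phi1] := H.
have [v ev0] : exists v, phi (v, [::]) != 0.
  apply/existsP; rewrite -negb_forall; apply/negP => /forallP h.
  move/eqP: phi1; rewrite big1 => [|v _]; last by apply/eqP.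
  by rewrite eq_sym oner_eq0.
have idem w : phi (w, [::]) * phi (w, [::]) = phi (w, [::]).
  by rewrite -phiM /pmul /valid /pend /= eqxx.
have ev1 : phi (v, [::]) = 1 by apply: (mulfI ev0); rewrite idem mulr1.
have ew0 w : w != v -> phi (w, [::]) = 0.
  move=> /negbTE nw; have := phiM (v, [::]) (w, [::]).
  by rewrite /pmul /valid /pend /= eq_sym nw /= ev1 mul1r.
have start w s : phi (w, s) = phi (w, [::]) * phi (w, s).
  have [vp|vp] := boolP (valid src tgt (w, s)); last first.
    by rewrite (mulrep_invalid H) ?mulr0 // (negbTE vp).
  by rewrite -phiM /pmul vp /pend /= eqxx.
have off w s : w != v -> phi (w, s) = 0 by move=> /ew0 e; rewrite start e mul0r.
pose f x := if src x == v then phi (v, [:: x]) else 0.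
have floop x : f x <> 0 -> src x = v /\ tgt x = v.
  rewrite /f; case: eqVneq => // sx; case: (eqVneq (tgt x) v) => // tx [].
  have := phiM (v, [:: x]) (tgt x, [::]).
  by rewrite /pmul /valid /pend /= sx !eqxx /= (off (tgt x)) // mulr0.
exists v, f; split=> // -[w s]; rewrite /rep /=.
case: (eqVneq w v) => [->|]; last exact: off.
elim: s => [|x s IH]; first by rewrite big_nil ev1.
rewrite big_cons -IH /f; case: (eqVneq (src x) v) => sx; last first.
  by rewrite mul0r (mulrep_invalid H) // /valid /= (negbTE sx).
have [tx|tx] := eqVneq (tgt x) v.
  rewrite -phiM /pmul /pend /= tx eqxx andbT.
  case: ifP => //= /negbT; rewrite /valid /= sx eqxx /= => /negbTE nv.
  by rewrite (mulrep_invalid H) // /valid /= sx eqxx tx /=.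
have := phiM (v, [:: x]) (tgt x, s).
have := phiM (v, [:: x]) (tgt x, [::]).
rewrite /pmul /pend /valid /= sx !eqxx /= (off (tgt x) [::]) // (off (tgt x) s) // !mulr0.
rewrite andbT => -> ; rewrite mul0r; case: ifP => //= nv _.
by rewrite (mulrep_invalid H) // /valid /= sx eqxx.
Qed.

(* As {poly K} is a domain, a generator in [Gp] killed by [rep v f] contains an arrow
   killed by [f]. *)
Lemma rep_specialize (v : 'I_n) (f : E -> {poly K}) (B : algType K) (f' : E -> B) :
  mulrep (rep v f) -> (forall x, f x <> 0 -> src x = v /\ tgt x = v) ->
  (forall x, f x = 0 -> f' x = 0) -> mulrep (rep v f').
Proof.
move=> [_ kG _] floop ff'; apply: rep_mulrep => [x fx|[w s] /kG].
  by apply: floop => /ff'.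
rewrite /rep /=; case: eqP => // _ /eqP; rewrite prodf_seq_eq0 => /hasP [x xs /eqP fx].
have [s1 s2] := splitPr xs.
by rewrite big_cat /= big_cons (ff' _ fx) mul0r mulr0.
Qed.

Lemma eq_mulrep (B : algType K) (phi psi : path -> B) :
  phi =1 psi -> mulrep phi -> mulrep psi.
Proof.
move=> e [phiM phiG phi1]; split.
- move=> p q; rewrite -!e -phiM; by case: (mulp p q) => [r|] //=; rewrite e.
- by move=> p /phiG; rewrite e.
- by rewrite -phi1; apply: eq_bigr => v _; rewrite e.
Qed.

(** Commutation identifies the three cubic monomials of each relation. *)
Lemma sat_comm (B : algType K) (d u : B) : du_sat a b g d u -> d * u = u * d ->
  (1 - a - b) *: (d * d * u) = g *: d /\ (1 - a - b) *: (d * u * u) = g *: u.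
Proof.
move=> [+ +] c.
have -> : d * u * d = d * d * u by rewrite -mulrA -c mulrA.
have -> : u * d * d = d * d * u by rewrite -c -mulrA -c mulrA.
have -> : u * d * u = d * u * u by rewrite -c.
have -> : u * u * d = d * u * u by rewrite -mulrA -c mulrA c.
move: (d * d * u) (d * u * u) => X Y eX eY.
rewrite !scalerBl !scale1r; split; apply/eqP; rewrite !subr_eq.
  by rewrite {1}eX addrC [a *: X + _]addrC addrA.
by rewrite {1}eY addrC [a *: Y + _]addrC addrA.
Qed.

Lemma pullback_rep (d u : {poly K}) : du_sat a b g d u ->
  exists v f, [/\ mulrep (rep v f), forall x, f x <> 0 -> src x = v /\ tgt x = v,
    rep v f =1 pullback d u & (ev (rep v f) D = d) /\ (ev (rep v f) U = u)].
Proof.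
move=> s; have H := pullback_mulrep s; have [v [f [e fl]]] := mulrep_domain H.
exists v, f; split=> //; first exact: eq_mulrep H.
by split; [rewrite -[RHS](pullback_D s) | rewrite -[RHS](pullback_U s)]; apply: eq_ev.
Qed.

(** Generators of I have positive length, so each vertex carries the character killing all
    arrows. *)
Lemma rep_const0 (B : algType K) v : mulrep (rep v (fun=> 0 : B)).
Proof.
apply: rep_mulrep => // -[w [|x s]] /Gp_long [_] //= _.
by rewrite /rep /=; case: eqP; rewrite // big_cons mul0r.
Qed.

(** * The case of nonzero g *)

Section NonzeroGamma.
Hypothesis g0 : g != 0.

(** Otherwise [x] could be sent to ['X]. Commutation then gives d ((1 - a - b) u) = g if d is
    nonzero, and u = 0 if d = 0; either way d and u are constants and cannot generate ['X]. *)
Lemma no_polynomial_loop v (f : E -> {poly K}) x : mulrep (rep v f) ->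
  (forall x, f x <> 0 -> src x = v /\ tgt x = v) -> f x = 0.
Proof.
move=> H fl; have [//|/eqP fx] := eqVneq (f x) 0.
pose f' y : {poly K} := if y == x then 'X else 0.
have H' : mulrep (rep v f').
  apply: rep_specialize H fl _ => y fy; rewrite /f'; case: eqP => // yx.
  by rewrite -yx in fx.
have := mulrep_lift (v, [:: x]) H'; have := mulrep_sat H'.
move: (ev _ D) (ev _ U) => d u sat; rewrite rep_arrow /f' eqxx => e.
exfalso; have [e1 e2] := sat_comm sat (mulrC d u).
suff [sd su] : (size d <= 1)%N /\ (size u <= 1)%N.
  exact: (ev_wprod_const sd su (esym e)).
have [d0|d0] := eqVneq d 0.
  move: e2; rewrite d0 !mul0r scaler0 => /esym /eqP.
  by rewrite scaler_eq0 (negbTE g0) => /eqP ->; rewrite size_poly0.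
have gP0 : g%:P != 0 by rewrite polyC_eq0.
have e3 : d * ((1 - a - b) *: u) = g%:P.
  by apply: (mulfI d0); rewrite mulrA -scalerAr e1 -mul_polyC mulrC.
have u1 : (1 - a - b) *: u != 0.
  by apply: contra_neq gP0 => u0; rewrite -e3 u0 mulr0.
have : size (d * ((1 - a - b) *: u)) = 1%N by rewrite e3 size_polyC g0.
rewrite size_mul //; move: u1; rewrite scaler_eq0 negb_or => /andP [s0 u1].
rewrite size_scale //; move: d0 u1; rewrite -!size_poly_gt0.
by case: (size d) => [|[|m]]; case: (size u) => [|[|k]] //=; rewrite ?addnS.
Qed.

Lemma gamma_sum_one : [pchar K] =i pred0 -> 1 - a - b = 0.
Proof.
move=> /pcharf0P ch; have [//|s0] := eqVneq (1 - a - b) 0; exfalso.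
(* Loops have value 0 in [{poly K}], so these finitely many scalars are the only possible constant
   values of D. *)
pose L := [seq (ev (rep v (fun=> 0 : {poly K})) D)`_0 | v : 'I_n].
have inL t : t != 0 -> t \in L.
  (* Chosen so that (1 - a - b) t u = g, which is both relations for commuting scalars. *)
  move=> t0; pose u := g / ((1 - a - b) * t).
  have sat : du_sat a b g t%:P u%:P.
    have tu : (1 - a - b) * (t * u) = g.
      by rewrite /u; field; rewrite s0 t0.
    split; rewrite -!mul_polyC -!polyCM -!polyCD; congr (_%:P).
      by rewrite -[in g * t]tu; ring.
    by rewrite -[in g * u]tu; ring.
  have [v [f [H fl _ [fD _]]]] := pullback_rep sat.
  apply/mapP; exists v; first by rewrite mem_enum.
  rewrite (_ : ev _ D = t%:P) ?coefC // -fD; apply: eq_ev => -[w s].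
  rewrite /rep /=; case: eqP => // _; apply: eq_bigr => x _.
  by rewrite (no_polynomial_loop x H fl).
clearbody L.
(* In characteristic 0 the scalars from 1 to [(size L).+1] are distinct and nonzero, too many to fit
   in [L]. *)
have := @uniq_leq_size _ [seq i.+1%:R : K | i <- iota 0 (size L).+1] L.
rewrite size_map size_iota ltnn => H; suff : false by []; apply: H.
  rewrite map_inj_uniq ?iota_uniq // => i j /eqP.
  wlog ij : i j / (i <= j)%N => [W|].
    by case: (leqP i j) => [/W//|/ltnW /W h]; rewrite eq_sym => /h ->.
  by rewrite eq_sym -subr_eq0 -natrB ?ltnS // ch subSS subn_eq0 => ji; apply/eqP; rewrite eqn_leq ij.
by move=> t /mapP [i _ ->]; apply: inL; rewrite ch.
Qed.

Hypothesis s0 : 1 - a - b = 0.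

Lemma sat_comm0 (B : algType K) (d u : B) :
  du_sat a b g d u -> d * u = u * d -> d = 0 /\ u = 0.
Proof.
move=> sat /(sat_comm sat) [/esym /eqP + /esym /eqP].
by rewrite s0 !scale0r !scaler_eq0 (negbTE g0) /= => /eqP ? /eqP.
Qed.

(** All characters [rep z (fun=> 0)] have d = u = 0, hence coincide; yet each takes the value 1 on
    its own trivial path and 0 on the others. *)
Lemma gamma_vertex (v w : 'I_n) : v = w.
Proof.
have H (z : 'I_n) : rep z (fun=> 0 : {poly K}) (v, [::]) =
    ev (wprod (0 : {poly K}) 0) (lift (v, [::])).
  rewrite (mulrep_lift _ (rep_const0 _ z)).
  by have [-> ->] := sat_comm0 (mulrep_sat (rep_const0 {poly K} z)) (mulrC _ _).
have := H w; rewrite -(H v) rep_e /rep /=; case: eqP => // _ /eqP.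
by rewrite eq_sym oner_eq0.
Qed.

(** Sending [x] to a square-zero matrix [N] kills all paths of length at least 2. The image lies in
    the commutative algebra spanned by 1 and [N], so d = u = 0, and these generate only scalars, not
    [N]. *)
Lemma gamma_no_arrow (x : E) : False.
Proof.
pose v := src x; pose N : 'M[K]_2 := delta_mx 0 1.
have NN : N * N = 0 by apply: mul_delta_mx_0.
pose f y := if y == x then N else 0.
have ff y z : f y * f z = 0.
  by rewrite /f; case: eqP; case: eqP; rewrite ?NN ?mulr0 ?mul0r.
have H : mulrep (rep v f).
  apply: rep_mulrep => [y _|[w [|y [|z s]]] /Gp_long [_] //= _].
    by split; apply: gamma_vertex.
  by rewrite /rep /=; case: eqP; rewrite // !big_cons mulrA ff mul0r.
pose S (A : 'M[K]_2) := exists c c', A = c *: 1 + c' *: N.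
have evS z : S (ev (rep v f) z).
  apply: ev_closed.
  - by exists 0, 0; rewrite !scale0r addr0.
  - move=> c A B [c1 [c2 ->]] [c3 [c4 ->]]; exists (c * c1 + c3), (c * c2 + c4).
    by rewrite scalerDr !scalerA !scalerDl addrACA.
  move=> [w s]; rewrite /rep /=; case: eqP => _; last first.
    by exists 0, 0; rewrite !scale0r addr0.
  case: s => [|y [|y' s]].
  - by exists 1, 0; rewrite big_nil scale1r scale0r addr0.
  - rewrite big_seq1 /f; case: eqP => _; last by exists 0, 0; rewrite !scale0r addr0.
    by exists 0, 1; rewrite scale1r scale0r add0r.
  - by exists 0, 0; rewrite !big_cons mulrA ff mul0r !scale0r addr0.
have Scomm A B : S A -> S B -> A * B = B * A.
  move=> [c1 [c2 ->]] [c3 [c4 ->]].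
  rewrite !mulrDl !mulrDr -!scalerAl -!scalerAr !mul1r !mulr1 NN !scaler0 !addr0 !scalerA.
  by rewrite [c3 * c1]mulrC [c3 * c2]mulrC [c4 * c1]mulrC -!addrA [X in _ + X]addrC.
have := mulrep_lift (v, [:: x]) H.
have [-> ->] := sat_comm0 (mulrep_sat H) (Scomm _ _ (evS D) (evS U)).
rewrite rep_arrow /f eqxx => e.
have : (ev (wprod (0 : 'M[K]_2) 0) (lift (v, [:: x]))) 0 1 = 0.
  apply: (@ev_closed _ _ _ (fun A : 'M[K]_2 => A 0 1 = 0)).
  - by rewrite mxE.
  - by move=> c A B A0 B0; rewrite !mxE A0 B0 mulr0 addr0.
  - move=> [|y w]; first by rewrite wprod_nil mxE.
    by rewrite wprod_cons; case: y; rewrite mul0r mxE.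
by rewrite -e mxE !eqxx /= => /eqP; rewrite oner_eq0.
Qed.

Lemma mul3E (A B : 'M[K]_3) i j :
  (A * B) i j = A i 0 * B 0 j + A i 1 * B 1 j + A i 2%:R * B 2%:R j.
Proof.
rewrite mxE !big_ord_recl big_ord0 addr0 !addrA.
by congr (_ + _ + _); congr (A _ _ * B _ _); apply: val_inj.
Qed.

(* The weight ladder [d v_i = l_i v_(i-1)], [u v_0 = m v_1], [u v_1 = v_2]. *)
Lemma nontrivial_rep3 : exists d u : 'M[K]_3, du_sat a b g d u /\ d <> 0.
Proof.
(* These are the relations on v_0, v_1, v_2: the first equation is the first relation at v_1, the
   second is the second relation at v_0, and the third comes from the top of the ladder, where u v_2
   = 0. Nonzero [l2] makes d nonzero. *)
have [l1 [l2 [m [h1 h2 h3 l20]]]] : exists l1 l2 m, [/\ l1 * (l2 - a * l1 * m - g) = 0,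
    m * (l2 - a * l1 * m - g) = 0, a * l2 + b * l1 * m + g = 0 & l2 != 0].
  have [a0|a0] := eqVneq a 0.
    have b1 : b = 1 by rewrite -[b]add0r -s0 a0; ring.
    by exists (- g), g, 1; rewrite a0 b1; split; rewrite //; ring.
  exists 0, (- g / a), 0; split; rewrite ?mul0r //; first by field.
  by rewrite mulf_neq0 ?oppr_eq0 ?invr_eq0.
pose d : 'M[K]_3 := \matrix_(i, j) (if (i == 0) && (j == 1) then l1
  else if (i == 1) && (j == 2%:R) then l2 else 0).
pose u : 'M[K]_3 := \matrix_(i, j) (if (i == 1) && (j == 0) then m
  else if (i == 2%:R) && (j == 1) then 1 else 0).
exists d, u; split; last first.
  move=> /(congr1 (fun A : 'M[K]_3 => A 1 2%:R)); rewrite !mxE /= => l0.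
  by rewrite l0 eqxx in l20.
have o3 (P : 'I_3 -> Prop) : P 0 -> P 1 -> P 2%:R -> forall i, P i.
  move=> P0 P1 P2 [[|[|[|//]]] hi].
  - by have -> : Ordinal hi = 0 by apply: val_inj.
  - by have -> : Ordinal hi = 1 by apply: val_inj.
  - by have -> : Ordinal hi = 2%:R by apply: val_inj.
have scE c (A : 'M[K]_3) i j : (c *: A) i j = c * A i j by rewrite mxE.
have adE (A B : 'M[K]_3) i j : (A + B) i j = A i j + B i j by rewrite mxE.
have dE i j : d i j = if (i == 0) && (j == 1) then l1
  else if (i == 1) && (j == 2%:R) then l2 else 0 by rewrite mxE.
have uE i j : u i j = if (i == 1) && (j == 0) then m
  else if (i == 2%:R) && (j == 1) then 1 else 0 by rewrite mxE.
split; apply/matrixP; apply: (o3); apply: (o3); rewrite !adE !scE !mul3E !dE !uE /=; try ring.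
all: apply/eqP; rewrite -subr_eq0; apply/eqP.
- by rewrite -[RHS]h1; ring.
- by rewrite -[RHS](mulr0 (- l2)) -[X in _ = _ * X]h3; ring.
- by rewrite -[RHS]h2; ring.
- by rewrite -[RHS](mulr0 (- 1)) -[X in _ = _ * X]h3; ring.
Qed.

(** With one vertex and no arrow, every representation takes scalar values, so d and u commute and d
    = 0, against [nontrivial_rep3]. *)
Lemma gamma_absurd : False.
Proof.
have [d [u [sat d0]]] := nontrivial_rep3.
have H := pullback_mulrep sat; have [_ _ H1] := H.
have sc p : exists c : K, pullback d u p = c *: 1.
  have [vp|/negbTE vp] := boolP (valid src tgt p); last first.
    by exists 0; rewrite scale0r (mulrep_invalid H vp).
  exists 1; case: p vp => w [|x s] vp; last by case: (gamma_no_arrow x).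
  rewrite scale1r -H1 (bigD1 w) //= big1 ?addr0 // => z.
  by rewrite (gamma_vertex z w) eqxx.
have scev y : exists c : K, ev (pullback d u) y = c *: 1.
  apply: (@ev_closed _ _ _ (fun A => exists c : K, A = c *: 1)) => //.
    by exists 0; rewrite scale0r.
  by move=> c A B [c1 ->] [c2 ->]; exists (c * c1 + c2); rewrite scalerDl scalerA.
have [[c ed] [c' eu]] := (scev D, scev U).
move: ed eu; rewrite pullback_D // pullback_U // => ed eu.
apply: d0; have [|//] := sat_comm0 sat.
by rewrite ed eu -!scalerAl -!scalerAr !mul1r !scalerA mulrC.
Qed.

End NonzeroGamma.

(** * Linear parts of loop representations *)

Lemma coef_scaled (M : eqType) (V : lmodType K) (w : V) m (x : lc K M) :
  coef x m *: w = ev (fun m' => (m' == m)%:R *: w) x.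
Proof.
rewrite coef_sum_indicator scaler_suml; apply: eq_bigr => p _.
by rewrite scalerA.
Qed.

(** [S] plays the part of terms of order at least 2: it absorbs all paths of length at least 2,
    leaving the trivial path at [v] and the two loops. *)
Lemma rep_linear_part (B : algType K) (S : B -> Prop) v (f : E -> B) x y (Y : lc K path) :
  S 0 -> (forall c A A', S A -> S A' -> S (c *: A + A')) -> x != y ->
  (forall z, z != x -> z != y -> f z = 0) ->
  (forall z t s, S (f z * (f t * \prod_(w <- s) f w))) ->
  S (ev (rep v f) Y - (coef Y (v, [::]) *: 1 + coef Y (v, [:: x]) *: f x
     + coef Y (v, [:: y]) *: f y)).
Proof.
move=> S0 SD xy fz S2; rewrite !coef_scaled -!ev_add.
rewrite -ev_opp -ev_add; apply: (ev_closed _ S0 SD).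
case=> w s; rewrite /rep /= !xpair_eqE /=.
have [_|_] := eqVneq w v; last by rewrite !scale0r !addr0 subrr.
case: s => [|z [|t s]] /=.
- by rewrite big_nil /= !scale0r !addr0 scale1r subrr.
- rewrite big_seq1 !eqseq_cons !andbT /= scale0r add0r.
  have [->|zx] := eqVneq z x; first by rewrite (negbTE xy) scale0r scale1r addr0 subrr.
  rewrite scale0r add0r; have [->|zy] := eqVneq z y; first by rewrite scale1r subrr.
  by rewrite fz // scale0r subrr.
- by rewrite !eqseq_cons !andbF !big_cons /= !scale0r !addr0 subr0; apply: S2.
Qed.

Lemma rep_poly_linear_part v (f : E -> {poly K}) x y (Y : lc K path) :
  x != y -> (forall z, z != x -> z != y -> f z = 0) ->
  (forall z, (f z)`_0 = 0) ->
  (ev (rep v f) Y)`_0 = coef Y (v, [::]) /\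
  (ev (rep v f) Y)`_1 = coef Y (v, [:: x]) * (f x)`_1 + coef Y (v, [:: y]) * (f y)`_1.
Proof.
move=> xy fz f0; pose S (p : {poly K}) := p`_0 = 0 /\ p`_1 = 0.
have := @rep_linear_part _ S v f x y Y _ _ xy fz _.
case.
- by split; rewrite coef0.
- by move=> c p q [p0 p1] [q0 q1]; split; rewrite coefD coefZ ?p0 ?p1 ?q0 ?q1 mulr0 addr0.
- move=> z t s; split; rewrite !coefM !big_ord_recl !big_ord0 /= !coefM !big_ord_recl !big_ord0 /=.
    by rewrite f0 mul0r addr0.
  by rewrite !f0 !(mul0r, add0r, addr0, mulr0).
rewrite !coefB !coefD !coefZ !coef1 !f0 !mulr0 !addr0 mulr1 add0r.
by move=> /eqP + /eqP; rewrite !subr_eq0 => /eqP ? /eqP.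
Qed.

Lemma rep_upper_linear_part v (f : E -> 'M[K]_4) x y (Y : lc K path) :
  x != y -> (forall z, z != x -> z != y -> f z = 0) -> (forall z, upper 1 (f z)) ->
  upper 2 (ev (rep v f) Y - (coef Y (v, [::]) *: 1 + coef Y (v, [:: x]) *: f x
     + coef Y (v, [:: y]) *: f y)).
Proof.
move=> xy fz up; apply: (@rep_linear_part _ (@upper K 2)) => //.
- exact: upper0.
- exact: upper_lin.
move=> z w s; rewrite mulrA; apply: (@upperM K 2 0); first exact: (@upperM K 1 1).
by apply: upper_prod => *; apply: upperW (up _).
Qed.

(** * The case g = 0 *)

Section ZeroGamma.
Hypothesis g0 : g = 0.

Lemma sat0 (B : algType K) (d u : B) : du_sat a b g d u ->
  d * d * u = a *: (d * u * d) + b *: (u * d * d) /\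
  d * u * u = a *: (u * d * u) + b *: (u * u * d).
Proof. by rewrite /du_sat g0 !scale0r !addr0. Qed.

(** * No two loops are nonzero in the same polynomial representation *)

Section TwoLoops.
Variables (v : 'I_n) (f : E -> {poly K}) (x y : E).
Hypotheses (H : mulrep (rep v f)) (fl : forall z, f z <> 0 -> src z = v /\ tgt z = v).
Hypotheses (xy : x != y) (fx : f x != 0) (fy : f y != 0).

Definition assign (B : algType K) (A A' : B) z : B :=
  if z == x then A else if z == y then A' else 0.

(** Arrows killed by [f] differ from [x] and [y], so [rep_specialize] allows arbitrary, possibly
    noncommuting, values on these two loops. *)
Lemma assign_mulrep (B : algType K) (A A' : B) : mulrep (rep v (assign A A')).
Proof.
apply: rep_specialize H fl _ => z fz; rewrite /assign.
case: eqP fz => [-> fz|_ fz]; first by move: (fx); rewrite fz eqxx.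
by case: eqP fz => [-> fz|//]; move: (fy); rewrite fz eqxx.
Qed.

Lemma assign_x (B : algType K) (A A' : B) : assign A A' x = A.
Proof. by rewrite /assign eqxx. Qed.

Lemma assign_y (B : algType K) (A A' : B) : assign A A' y = A'.
Proof. by rewrite /assign eq_sym (negbTE xy) eqxx. Qed.

Lemma assign_other (B : algType K) (A A' : B) z :
  z != x -> z != y -> assign A A' z = 0.
Proof. by rewrite /assign => /negbTE -> /negbTE ->. Qed.

(** Send the loops to ['X^2] and ['X^3]. Otherwise commutation forces d = 0 or u = 0, against
    [cusp_not_wprod]. *)
Lemma two_loops_sum_one : 1 - a - b = 0.
Proof.
have [//|s0] := eqVneq (1 - a - b) 0; exfalso.
pose h := assign ('X^2 : {poly K}) 'X^3.
have Hh := assign_mulrep ('X^2 : {poly K}) 'X^3.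
have h1 z : (h z)`_0 = 0 /\ (h z)`_1 = 0.
  by rewrite /h /assign; case: eqP => _; [|case: eqP => _]; rewrite ?coefXn ?coef0.
have d1 Y : (ev (rep v h) Y)`_1 = 0.
  have [_ ->] := @rep_poly_linear_part v h x y Y xy
     (@assign_other _ _ _) (fun z => (h1 z).1).
  by rewrite (h1 x).2 (h1 y).2 !mulr0 addr0.
have [+ _] := sat_comm (mulrep_sat Hh) (mulrC _ _).
rewrite g0 scale0r => /eqP; rewrite scaler_eq0 (negbTE s0) /= !mulf_eq0 orbb => /orP du.
have ex := mulrep_lift (v, [:: x]) Hh; have ey := mulrep_lift (v, [:: y]) Hh.
rewrite !rep_arrow assign_x assign_y in ex ey.
apply: (cusp_not_wprod (d1 D) (d1 U)); last 2 first.
- exact: (esym ex).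
- exact: (esym ey).
by case: du => /eqP; [left|right].
Qed.

Notation Dx := (coef D (v, [:: x])).
Notation Dy := (coef D (v, [:: y])).
Notation Ux := (coef U (v, [:: x])).
Notation Uy := (coef U (v, [:: y])).

(** Send the loops to p ['X] and q ['X]. If D and U have no linear term, nothing they generate has
    one, including the values of the loops. *)
Lemma linear_parts_free p q : Dx * p + Dy * q = 0 -> Ux * p + Uy * q = 0 ->
  p = 0 /\ q = 0.
Proof.
move=> eD eU; pose h := assign (p *: 'X : {poly K}) (q *: 'X).
have Hh := assign_mulrep (p *: 'X : {poly K}) (q *: 'X).
have h0 z : (h z)`_0 = 0.
  by rewrite /h /assign; case: eqP => _; [|case: eqP => _]; rewrite ?coefZ ?coefX ?coef0 ?mulr0.
have d1 Y : (ev (rep v h) Y)`_1 = coef Y (v, [:: x]) * p + coef Y (v, [:: y]) * q.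
  have [_ ->] := @rep_poly_linear_part v h x y Y xy (@assign_other _ _ _) h0.
  by rewrite /h assign_x assign_y !coefZ !coefX !mulr1.
have L w : (ev (wprod (ev (rep v h) D) (ev (rep v h) U)) w)`_1 = 0.
  by apply: coef1_ev_wprod; rewrite d1.
have ex := mulrep_lift (v, [:: x]) Hh; have ey := mulrep_lift (v, [:: y]) Hh.
rewrite !rep_arrow assign_x assign_y in ex ey.
have := L (lift (v, [:: x])); have := L (lift (v, [:: y])).
by rewrite /h -ex -ey !coefZ !coefX !mulr1.
Qed.

Lemma no_two_loops : False.
Proof.
pose t := Dx * Uy - Dy * Ux.
have t0 : t != 0.
  (* If the determinant [t] vanishes, (Dy, -Dx) and (Uy, -Ux) solve the homogeneous system, so all
     four coefficients are 0 and then (1, 0) is a solution. *)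
  apply/eqP => t0.
  have [] := @linear_parts_free Dy (- Dx); first by ring.
    by rewrite -[RHS]oppr0 -[in RHS]t0 /t; ring.
  have [] := @linear_parts_free Uy (- Ux); first by rewrite -[RHS]t0 /t; ring.
    by ring.
  move=> u1 /eqP; rewrite oppr_eq0 => /eqP u2 d1 /eqP; rewrite oppr_eq0 => /eqP d2.
  have [] := @linear_parts_free 1 0; rewrite ?d1 ?d2 ?u1 ?u2 ?mul0r ?addr0 //.
  by move=> /eqP; rewrite oner_eq0.
(* Cramer's rule: with these values on [x] and [y], the linear parts of D and U become [P4] and
   [Q4]. *)
pose A := (Uy / t) *: P4 K - (Dy / t) *: Q4 K.
pose A' := (Dx / t) *: Q4 K - (Ux / t) *: P4 K.
have Hh := assign_mulrep A A'; pose h := assign A A'.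
have up z : upper 1 (h z).
  have uAB c c' : upper 1 (c *: P4 K - c' *: Q4 K).
    rewrite addrC -scaleNr; apply: upper_lin; first exact: upper_Q4.
    by rewrite -[c *: _]addr0; apply: upper_lin; [exact: upper_P4|exact: upper0].
  rewrite /h /assign; case: eqP => _; first exact: uAB.
  case: eqP => _; last exact: upper0.
  have -> : A' = (- (Ux / t)) *: P4 K - (- (Dx / t)) *: Q4 K; last exact: uAB.
  by rewrite !scaleNr opprK addrC.
have lin Y : upper 2 (ev (rep v h) Y - (coef Y (v, [::]) *: 1
    + coef Y (v, [:: x]) *: A + coef Y (v, [:: y]) *: A')).
  have := @rep_upper_linear_part v h x y Y xy (@assign_other _ _ _) up.
  by rewrite /h assign_x assign_y.
have [rD _] := sat0 (mulrep_sat Hh).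
have solveD (V : lmodType K) (P Q : V) :
    Dx *: ((Uy / t) *: P - (Dy / t) *: Q) + Dy *: ((Dx / t) *: Q - (Ux / t) *: P) = P.
  rewrite !scalerBr !scalerA (_ : Dy * (Dx / t) = Dx * (Dy / t)); last by ring.
  rewrite addrA addrNK -scalerBl (_ : _ - _ = 1) ?scale1r //.
  by rewrite -[RHS](divff t0) {3}/t; ring.
have solveU (V : lmodType K) (P Q : V) :
    Ux *: ((Uy / t) *: P - (Dy / t) *: Q) + Uy *: ((Dx / t) *: Q - (Ux / t) *: P) = Q.
  rewrite !scalerBr !scalerA (_ : Uy * (Ux / t) = Ux * (Uy / t)); last by ring.
  rewrite addrC addrA addrNK -scalerBl (_ : _ - _ = 1) ?scale1r //.
  by rewrite -[RHS](divff t0) {3}/t; ring.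
apply: (@no_upper4 K a b (coef D (v, [::])) (coef U (v, [::])) _ _ _ _ rD).
- have -> : (coef D (v, [::]))%:M + P4 K = coef D (v, [::]) *: 1 + Dx *: A + Dy *: A'.
    by rewrite -addrA solveD -scalemx1.
  exact: lin.
- have -> : (coef U (v, [::]))%:M + Q4 K = coef U (v, [::]) *: 1 + Ux *: A + Uy *: A'.
    by rewrite -addrA solveU -scalemx1.
  exact: lin.
- by left; apply: two_loops_sum_one.
Qed.

End TwoLoops.

(** * The loops representing d and u, and the vanishing of a and b *)

Lemma unique_loop v (f : E -> {poly K}) x z : mulrep (rep v f) ->
  (forall z, f z <> 0 -> src z = v /\ tgt z = v) -> f x != 0 -> z != x -> f z = 0.
Proof.
move=> H fl fx zx; have [//|fz] := eqVneq (f z) 0.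
by case: (no_two_loops H fl zx fz fx).
Qed.

Lemma ev_rep_comp v (f h : E -> {poly K}) Z Y : (forall z, f z = h z \Po Z) ->
  ev (rep v f) Y = ev (rep v h) Y \Po Z.
Proof.
move=> fE; rewrite (@ev_additive K path _ _ (rep v h) (comp_poly Z)).
apply: eq_ev => -[w s]; rewrite /rep /=; case: eqP => _; last by rewrite comp_poly0.
by rewrite rmorph_prod; apply: eq_bigr => z _; rewrite fE.
Qed.

Definition single (x z : E) : {poly K} := if z == x then 'X else 0.

Lemma loop_single v (f : E -> {poly K}) x : mulrep (rep v f) ->
  (forall z, f z <> 0 -> src z = v /\ tgt z = v) -> f x != 0 ->
  forall z, f z = single x z \Po f x.
Proof.
move=> H fl fx z; rewrite /single; have [->|zx] := eqVneq z x.
  by rewrite comp_polyX.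
by rewrite comp_poly0 (unique_loop H fl fx zx).
Qed.

(** Without a nonzero loop all values are constants, which is seen by writing the zero assignment as
    a substitution by 0. *)
Lemma exists_loop v (f : E -> {poly K}) Y : ev (rep v f) Y = 'X -> exists x, f x != 0.
Proof.
move=> e; have [[x /eqP fx]|none] := classic (exists x, f x <> 0); first by exists x.
have f0 z : f z = (0 : {poly K}) \Po 0.
  rewrite comp_poly0; have [//|/eqP fz] := eqVneq (f z) 0; case: none; by exists z.
have := ev_rep_comp v Y f0; rewrite e comp_poly0r => /(congr1 (fun p : {poly K} => p`_1)).
by rewrite coefX coefC /= => /eqP; rewrite oner_eq0.
Qed.

Lemma ideal_of_generator p q r q' t : Gp p -> mulp q p = Some r -> mulp r q' = Some t ->
  I [:: (1, t)].
Proof.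
move=> Gpp e1 e2.
have Gr : (fun r => exists p, Gp p /\ r = [:: (1 : K, p)]) [:: (1, p)] by exists p.
apply: ideal_lceq (ideal_gen mulp [:: (1, q)] [:: (1, q')] Gr).
by apply: ev_lceq => h; rewrite !ev_lcmul !ev1 e1 /= ev1 e2.
Qed.

Lemma gamma0_coefs : a = 0 /\ b = 0.
Proof.
have sat1 : du_sat a b g ('X : {poly K}) 0.
  by rewrite /du_sat g0 !mulr0 !mul0r !scaler0 scale0r !addr0.
have sat2 : du_sat a b g (0 : {poly K}) 'X.
  by rewrite /du_sat g0 !mul0r !mulr0 !mul0r !scaler0 scale0r !addr0.
have [v [f1 [H1 fl1 fE1 [fD1 fU1]]]] := pullback_rep sat1.
have [v2 [f2 [H2 fl2 fE2 [fD2 fU2]]]] := pullback_rep sat2.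
(* Both representations specialize at 0 to the character d = u = 0, so they live at the same
   vertex. *)
have e0 p : rep v f1 p \Po 0 = rep v2 f2 p \Po 0.
  by rewrite fE1 fE2 /pullback !ev_wprod_comp comp_polyX comp_poly0.
have ev2 : v2 = v.
  have := e0 (v, [::]); rewrite rep_e /rep /= -polyC1 comp_polyC.
  case: eqP => // _ /eqP; by rewrite comp_poly0 polyC_eq0 oner_eq0.
move: H2 fl2 fE2 fD2 fU2 e0; rewrite ev2 => H2 fl2 fE2 fD2 fU2 e0 {v2 ev2}.
have [x fx] := exists_loop fD1; have [y fy] := exists_loop fU2.
have f1x := loop_single H1 fl1 fx; have f2y := loop_single H2 fl2 fy.
have xy : x != y.
  (* If x = y, the values of D and U are polynomials [PD], [PU] in a single loop. In the second
     representation U has value ['X], so that loop is not constant; then D = 0 forces [PD] = 0,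
     although D has value ['X] in the first. *)
  apply/eqP => xy; move: fD1 fD2 fU2.
  rewrite (ev_rep_comp v D f1x) (ev_rep_comp v D f2y) (ev_rep_comp v U f2y) -xy.
  move: (ev (rep v (single x)) D) (ev (rep v (single x)) U) => PD PU eX.
  move=> /eqP e e'; move: e; rewrite comp_poly_eq0 => [/eqP P0|].
    by move: eX; rewrite P0 comp_poly0 => /esym /eqP; rewrite polyX_eq0.
  have := size_comp_poly PU (f2 x); rewrite e' size_polyX /=.
  by case: (size (f2 x)) => [|[|k]] //; rewrite muln0.
have f1o z (zx : z != x) : f1 z = 0 by apply: unique_loop H1 fl1 fx zx.
have f2o z (zy : z != y) : f2 z = 0 by apply: unique_loop H2 fl2 fy zy.
(* By [e0] the constant terms of both representations agree, and the second one kills [x]. *)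
have f10 z : (f1 z)`_0 = 0.
  have [->|/f1o ->] := eqVneq z x; last by rewrite coef0.
  have := e0 (v, [:: x]); rewrite !rep_arrow (f2o x xy) comp_poly0 comp_poly0r.
  by move=> /eqP; rewrite polyC_eq0 => /eqP.
have yx : y != x by rewrite eq_sym.
have f20 z : (f2 z)`_0 = 0.
  have [->|/f2o ->] := eqVneq z y; last by rewrite coef0.
  have := e0 (v, [:: y]); rewrite !rep_arrow (f1o y yx) comp_poly0 comp_poly0r.
  by move=> /esym /eqP; rewrite polyC_eq0 => /eqP.
pose al := (f1 x)`_1; pose be := (f2 y)`_1.
have c1 Y := @rep_poly_linear_part v f1 x y Y xy (fun z zx _ => f1o z zx) f10.
have c2 Y := @rep_poly_linear_part v f2 x y Y xy (fun z _ zy => f2o z zy) f20.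
have [De Dx] := c1 D; have [Ue Ux] := c1 U; have [_ Dy] := c2 D; have [_ Uy] := c2 U.
move: De Dx Ue Ux Dy Uy.
rewrite fD1 fU1 fD2 fU2 !coef0 !coefX /= (f1o y yx) (f2o x xy) coef0 !mulr0 !addr0 !add0r.
rewrite -/al -/be => De Dx Ue Ux Dy Uy.
have al0 : al != 0 by apply/eqP => z; move: Dx; rewrite z mulr0 => /eqP; rewrite oner_eq0.
have be0 : be != 0 by apply/eqP => z; move: Uy; rewrite z mulr0 => /eqP; rewrite oner_eq0.
have Dy0 : coef D (v, [:: y]) = 0.
  by move/eqP: (esym Dy); rewrite mulf_eq0 (negbTE be0) orbF => /eqP.
have Ux0 : coef U (v, [:: x]) = 0.
  by move/eqP: (esym Ux); rewrite mulf_eq0 (negbTE al0) orbF => /eqP.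
have [[sx tx] [sy ty]] : (src x = v /\ tgt x = v) /\ (src y = v /\ tgt y = v).
  by split; [apply: fl1; apply/eqP | apply: fl2; apply/eqP].
have Ixxy : I [:: (1, (v, [:: x; x; y]))].
  pose h := assign x y (al *: P4 K) (be *: Q4 K).
  (* Either the matrices represent KQ/I, which [no_upper4] excludes, or some generator survives; it
     is then xx, xy or xxy and divides xxy. *)
  have [killed|] := classic (forall p, Gp p -> rep v h p = 0).
    have hl z : h z <> 0 -> src z = v /\ tgt z = v.
      by rewrite /h /assign; case: eqP => [->|_] //; case: eqP => [->|_].
    have Hh := rep_mulrep hl killed; have [rD _] := sat0 (mulrep_sat Hh).
    have up z : upper 1 (h z).
      have upZ c A : upper 1 A -> upper 1 (c *: A : 'M[K]_4).
        by move=> uA; rewrite -[c *: _]addr0; apply: upper_lin => //; apply: upper0.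
      rewrite /h /assign; case: eqP => _; first by apply: upZ; apply: upper_P4.
      by case: eqP => _; [apply: upZ; apply: upper_Q4 | apply: upper0].
    have lin Y := @rep_upper_linear_part v h x y Y xy (@assign_other _ _ _ _ _) up.
    have hx : h x = al *: P4 K by rewrite /h assign_x.
    have hy : h y = be *: Q4 K by rewrite /h assign_y.
    case: (@no_upper4 K a b 0 0 _ _ _ _ rD); last by right.
    - have := lin D; rewrite -De hx hy Dy0 !scale0r add0r addr0 scalerA -Dx scale1r.
      by rewrite raddf0 add0r.
    - have := lin U; rewrite -Ue hx hy Ux0 !scale0r !add0r scalerA -Uy scale1r.
      by rewrite raddf0 add0r.
  move=> nk; have [[w s] nkws] := not_all_ex_not _ _ nk.
  have [Gws] := imply_to_and _ _ nkws.
  rewrite /rep /=; case: eqP => // wv; rewrite wv in Gws.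
  have [_ len] := Gp_long Gws.
  have pm s1 s2 : valid src tgt (v, s1) -> valid src tgt (v, s2) ->
      pend tgt (v, s1) = v -> mulp (v, s1) (v, s2) = Some (v, s1 ++ s2).
    by move=> v1 v2 p1; rewrite /pmul v1 v2 p1 eqxx.
  case/(prod_PQ4_neq0 (assign_x _ _ _ _) (assign_y xy _ _) (@assign_other _ _ _ _ _) len) => /= es;
    rewrite es in Gws.
  - by apply: (@ideal_of_generator _ (v, [::]) _ (v, [:: y]) _ Gws);
      rewrite pm // /valid /pend /= ?sx ?sy ?tx ?ty ?eqxx.
  - by apply: (@ideal_of_generator _ (v, [:: x]) _ (v, [::]) _ Gws);
      rewrite pm // /valid /pend /= ?sx ?sy ?tx ?ty ?eqxx.
  - by apply: (@ideal_of_generator _ (v, [::]) _ (v, [::]) _ Gws);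
      rewrite pm // /valid /pend /= ?sx ?sy ?tx ?ty ?eqxx.
have Jxxy := @lift_mul3 (v, [:: x]) (v, [:: x]) (v, [:: y]) (v, [:: x; x]) (v, [:: x; x; y]).
have {}Jxxy : J (lcmul wmul (lcmul wmul (lift (v, [:: x])) (lift (v, [:: x]))) (lift (v, [:: y]))).
  apply: Jxxy => //; rewrite /pmul /valid /pend /= ?sx ?sy ?tx ?ty !eqxx //=.
(* The two representations read off the low-order terms of the lifts: [x] lifts to [al] d and [y] to
   [be] u, up to words of length at least 2. *)
have l1 z : (ev (wprod 'X 0) (lift (v, [:: z]))) = f1 z by rewrite -(rep_arrow v f1) fE1.
have l2 z : (ev (wprod 0 'X) (lift (v, [:: z]))) = f2 z by rewrite -(rep_arrow v f2) fE2.
have lin0 z : coef (lift (v, [:: z])) [::] = 0.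
  by rewrite -(@coef0_ev_wprod K 'X 0) ?l1 ?coefX ?coef0.
have xd : coef (lift (v, [:: x])) [:: dL] = al by rewrite -coef1_ev_wprodX0 l1.
have xu : coef (lift (v, [:: x])) [:: uL] = 0.
  by rewrite -coef1_ev_wprod0X l2 (f2o x xy) coef0.
have yd : coef (lift (v, [:: y])) [:: dL] = 0.
  by rewrite -coef1_ev_wprodX0 l1 (f1o y yx) coef0.
have yu : coef (lift (v, [:: y])) [:: uL] = be by rewrite -coef1_ev_wprod0X l2.
rewrite g0 in Jxxy.
have cub p q : a * p + b * q = 0.
  have := @cubic_du_ideal K a b p q _ Jxxy.
  rewrite ev_cubic_mul3 // xd yu => e.
  have /eqP : al * al * be * (a * p + b * q) = 0 by [].
  by rewrite !mulf_eq0 (negbTE al0) (negbTE be0) /= => /eqP.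
by split; [have := cub 1 0 | have := cub 0 1]; rewrite mulr1 mulr0 ?addr0 ?add0r.
Qed.
End ZeroGamma.
End MonomialPresentation.

(** * Transport of ideals along maps of bases *)

Section IdealTransfer.
Variables (K : fieldType) (M M' : eqType) (f : M -> M').
Variables (mulM : M -> M -> option M) (mulM' : M' -> M' -> option M').
Hypothesis fM : forall p q, mulM' (f p) (f q) = omap f (mulM p q).

Definition lcmap (x : lc K M) : lc K M' := [seq (p.1, f p.2) | p <- x].

Lemma ev_lcmap (V : lmodType K) (h : M' -> V) x : ev h (lcmap x) = ev (h \o f) x.
Proof. by rewrite /ev big_map. Qed.

Lemma ideal_lcmap (G : lc K M -> Prop) (G' : lc K M' -> Prop) x :
  (forall r, G r -> exists r', G' r' /\ lceq (lcmap r) r') ->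
  in_ideal mulM G x -> in_ideal mulM' G' (lcmap x).
Proof.
move=> GG'; move: x; apply: ideal_ind.
- move=> x y e; apply: ideal_lceq; apply: ev_lceq => h.
  by rewrite !ev_lcmap (lceq_ev _ e).
- exact: ideal_nil.
- by move=> x y Ix Iy; rewrite /lcmap map_cat; apply: ideal_cat.
- move=> x r y /GG' [r' [Gr' e]].
  apply: ideal_lceq (ideal_gen mulM' (lcmap x) (lcmap y) Gr'); apply: ev_lceq => h.
  rewrite ev_lcmap !ev_lcmul ev_lcmap; apply: eq_ev => p /=.
  rewrite -(lceq_ev _ e) ev_lcmap; apply: eq_ev => q /=.
  rewrite fM; case: (mulM p q) => //= m; rewrite ev_lcmap; apply: eq_ev => k /=.
  by rewrite fM; case: (mulM m k).
Qed.

End IdealTransfer.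

(** * A(0,0,0) as a monomial algebra on one vertex with two loops *)

Section ZeroParameters.
Variable K : fieldType.
Let E : eqType := bool.
Let st : E -> 'I_1 := fun=> ord0.
Let loops (w : word) : qpath 1 E := (ord0, w).
Let Gp (p : qpath 1 E) := p = loops [:: dL; dL; uL] \/ p = loops [:: dL; uL; uL].
Let D : lc K (qpath 1 E) := [:: (1, loops [:: dL])].
Let U : lc K (qpath 1 E) := [:: (1, loops [:: uL])].

Lemma rose_valid p : valid st st p.
Proof.
by case: p => v s; rewrite /valid /=; elim: s v => //= x s IH v; rewrite (ord1 v) IH.
Qed.

Lemma rose_pmul p q : pmul st st p q = Some (loops (p.2 ++ q.2)).
Proof. by rewrite /pmul !rose_valid (ord1 (pend _ _)) (ord1 q.1) (ord1 p.1) eqxx. Qed.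

Lemma rose_img (V : lmodType K) (h : qpath 1 E -> V) w :
  ev h (word_img st st D U w) = h (loops w).
Proof.
elim: w h => [|x w IH] h /=; first by rewrite ev_qunit big_ord1.
rewrite ev_lcmul; have -> : (if x then U else D) = [:: (1, loops [:: x])] by case: x.
by rewrite ev1 IH rose_pmul.
Qed.

(** With zero parameters the relations are the single words ddu and duu. Paths of this quiver are
    words, so the map to KQ is a relabelling and ideals transfer along [loops] and its inverse
    [snd]. *)
Lemma down_up_monomial0 : down_up_monomial (0 : K) 0 0.
Proof.
exists 1%N, E, st, st, Gp; split; first by move=> p [] ->.
have KQ y : in_KQ st st y by apply/allP => p _; apply: rose_valid.
have FE x : lceq (free_to_KQ st st D U x) (lcmap loops x).
  by apply: ev_lceq => h; rewrite ev_F ev_lcmap; apply: eq_ev => w; apply: rose_img.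
have rel1 (h : word -> K^o) : ev h (du_rel1 0 0 0) = h [:: dL; dL; uL].
  by rewrite ev_du_rel1 !scale0r !addr0 subr0.
have rel2 (h : word -> K^o) : ev h (du_rel2 0 0 0) = h [:: dL; uL; uL].
  by rewrite ev_du_rel2 !scale0r !addr0 subr0.
exists D, U; split=> // [y _|x].
  exists (lcmap snd y); apply: ideal_lceq (ideal_nil _ _); apply: ev_lceq => h.
  rewrite ev_sub (lceq_ev h (FE _)) !ev_lcmap (eq_ev _ (h' := h)) ?subrr ?ev_nil //.
  by case=> v s /=; rewrite (ord1 v).
split=> H.
  have sndM p q : wmul p.2 q.2 = omap snd (pmul st st p q) by rewrite rose_pmul.
  have : du_ideal 0 0 0 (lcmap snd (free_to_KQ st st D U x)).
    apply: (ideal_lcmap sndM _ H) => _ [p [[] -> ->]].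
      by exists (du_rel1 0 0 0); split; [left | apply: ev_lceq => h; rewrite ev_lcmap rel1 ev1].
    by exists (du_rel2 0 0 0); split; [right | apply: ev_lceq => h; rewrite ev_lcmap rel2 ev1].
  apply: ideal_lceq; apply: ev_lceq => h.
  by rewrite ev_lcmap (lceq_ev _ (FE x)) ev_lcmap; apply: eq_ev.
apply: ideal_lceq (lceq_sym (FE x)) _.
have loopsM p q : pmul st st (loops p) (loops q) = omap loops (wmul p q).
  by rewrite rose_pmul.
apply: (ideal_lcmap loopsM _ H) => r [] ->.
  exists [:: (1, loops [:: dL; dL; uL])]; split; first by exists (loops [:: dL; dL; uL]); split; [left|].
  by apply: ev_lceq => h; rewrite ev_lcmap rel1 ev1.
exists [:: (1, loops [:: dL; uL; uL])]; split; first by exists (loops [:: dL; uL; uL]); split; [right|].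
by apply: ev_lceq => h; rewrite ev_lcmap rel2 ev1.
Qed.

End ZeroParameters.

Theorem theorem2 (K : fieldType) (hK : [pchar K] =i pred0) (a b g : K) :
  down_up_monomial a b g <-> (a = 0 /\ b = 0 /\ g = 0).
Proof.
split=> [|[-> [-> ->]]]; last exact: down_up_monomial0.
move=> [n [E [src [tgt [Gp [Gl [D [U [DK UK surj ker]]]]]]]]].
have [g0|g0] := eqVneq g 0.
  by have [] := gamma0_coefs Gl DK UK surj ker g0.
case: (gamma_absurd Gl DK UK surj ker g0).
(* Characteristic 0 supplies the infinitely many scalars that force 1 - a - b = 0. *)
exact: (gamma_sum_one Gl DK UK surj ker g0 hK).
Qed.
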